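(* Let $\mathcal{H}$ be a family of graphs containing a path with at most $4$ vertices. For every fixed $k$, there is an algorithm that, given a vertex-weighted graph $(G,\mathsf{w})$ with $n=|V(G)|$, in time $n^{\mathcal{O}(\log^2 n)}$ either solves \textsc{Max Weight Independent Set} in $(G,\mathsf{w})$ (i.e., computes an independent set of $G$ of maximum total weight), or correctly reports that $\text{tree-}\pi_{\mathcal{H}}(G)>k$.
   Context: Graphs are finite, without loops or parallel edges. A vertex-weighted graph is a pair $(G,\mathsf{w})$ with $\mathsf{w}:V(G)\to\mathbb{Q}_{\ge 0}$; computations on weights take constant time. Disjoint vertex sets are anticomplete if there is no edge between them; subgraphs are pairwise anticomplete if their vertex sets are pairwise disjoint and anticomplete. \textsc{Max Weight Independent Set}: given $(G,\mathsf{w})$, find a set of pairwise non-adjacent vertices of maximum total weight. For a family $\mathcal{H}$ of graphs, an induced $\mathcal{H}$-packing in $G$ is a set of pairwise anticomplete induced subgraphs of $G$, each isomorphic to a member of $\mathcal{H}$. For $B\subseteq V(G)$, it is $B$-rooted if every member of the packing intersects $B$ (members need not be contained in $B$), and $\pi_{\mathcal{H}}(G,B)$ is the largest size of a $B$-rooted induced $\mathcal{H}$-packing. For a tree decomposition $\mathcal{T}=(T,\beta)$ of $G$ let $\pi_{\mathcal{H}}(G,\mathcal{T})=\max_{t\in V(T)}\pi_{\mathcal{H}}(G,\beta(t))$. The induced $\mathcal{H}$-packing treewidth is $\text{tree-}\pi_{\mathcal{H}}(G)=\min_{\mathcal{T}}\pi_{\mathcal{H}}(G,\mathcal{T})$ over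 all tree decompositions $\mathcal{T}$ of $G$. *)

(* Defs.v *)
From HB Require Import structures.
From mathcomp Require Import all_boot all_order all_algebra.
From mathcomp Require Import boolp.

Set Implicit Arguments.
Unset Strict Implicit.
Unset Printing Implicit Defensive.

Import Order.TTheory GRing.Theory Num.Theory.

(** * Graphs *)

Record sgraph := SGraph {
  vertex :> finType;
  edge : rel vertex;
  edge_sym : symmetric edge;
  edge_irr : irreflexive edge
}.

Arguments edge {s} x y.

Definition graph_iso (G1 G2 : sgraph) : Prop :=
  exists f : G1 -> G2, bijective f /\ forall x y, edge (f x) (f y) = edge x y.

Section Induced.
Variables (G : sgraph) (S : {set G}).

Definition induced_edge : rel {x : G | x \in S} :=
  fun x y => edge (val x) (val y).

Lemma induced_edge_sym : symmetric induced_edge.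
Proof. by move=> x y; rewrite /induced_edge edge_sym. Qed.

Lemma induced_edge_irr : irreflexive induced_edge.
Proof. by move=> x; rewrite /induced_edge edge_irr. Qed.

Definition induced : sgraph := SGraph induced_edge_sym induced_edge_irr.
End Induced.

Section PathGraph.
Variable s : nat.

Definition path_edge : rel 'I_s :=
  fun i j => (i.+1 == j :> nat) || (j.+1 == i :> nat).

Lemma path_edge_sym : symmetric path_edge.
Proof. by move=> i j; rewrite /path_edge orbC. Qed.

Lemma path_edge_irr : irreflexive path_edge.
Proof. by move=> i; rewrite /path_edge orbb gtn_eqF. Qed.

(* The path with [s] vertices (hence [s.-1] edges). *)
Definition path_graph : sgraph := SGraph path_edge_sym path_edge_irr.
End PathGraph.

Definition anticomplete (G : sgraph) (A B : {set G}) : Prop :=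
  [disjoint A & B] /\ forall x y, x \in A -> y \in B -> ~~ edge x y.

(** * Induced packings and induced packing treewidth *)

(* An induced subgraph is determined by its vertex set, so a packing is a set
   of vertex sets. *)
Definition induced_packing (H : sgraph -> Prop) (G : sgraph)
    (P : {set {set G}}) : Prop :=
  (forall S, S \in P -> exists F, H F /\ graph_iso (induced S) F) /\
  (forall S S', S \in P -> S' \in P -> S != S' -> anticomplete S S').

Definition rooted_packing (H : sgraph -> Prop) (G : sgraph) (B : {set G})
    (P : {set {set G}}) : Prop :=
  induced_packing H P /\ forall S, S \in P -> S :&: B != set0.

Definition packing_number (H : sgraph -> Prop) (G : sgraph) (B : {set G}) : nat :=
  \max_(P : {set {set G}} | `[< rooted_packing H B P >]) #|P|.

(* [ucycle] allows the closed walks x, y, x along a single edge, which are the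
   duplicate-free cycles of size 2; a cycle of a graph has size at least 3. *)
Definition is_tree (T : sgraph) : Prop :=
  [/\ 0 < #|T|,
      forall x y : T, connect edge x y
    & forall c : seq T, ucycle edge c -> size c < 3].

Record tree_decomposition (G : sgraph) := TreeDecomposition {
  td_tree : sgraph;
  td_bag : td_tree -> {set G};
  td_is_tree : is_tree td_tree;
  td_vertex : forall x : G, exists t, x \in td_bag t;
  td_edge : forall x y : G, edge x y ->
    exists t, (x \in td_bag t) && (y \in td_bag t);
  td_connected : forall (x : G) (t t' : td_tree),
    x \in td_bag t -> x \in td_bag t' ->
    connect [rel u v | [&& x \in td_bag u, x \in td_bag v & edge u v]] t t'
}.

Definition packing_width (H : sgraph -> Prop) (G : sgraph)
    (D : tree_decomposition G) : nat :=
  \max_(t : td_tree D) packing_number H (td_bag t).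

Section TrivialDecomposition.
Variable G : sgraph.

Lemma path_graph1_tree : is_tree (path_graph 1).
Proof.
split; first by rewrite card_ord.
  by move=> x y; rewrite (ord1 x) (ord1 y) connect0.
move=> c /andP[_ uc]; have := card_uniqP uc => <-.
by rewrite (leq_ltn_trans (max_card _)) // card_ord.
Qed.

Definition trivial_decomposition : tree_decomposition G.
Proof.
refine (@TreeDecomposition G (path_graph 1) (fun=> setT) path_graph1_tree _ _ _).
- by move=> x; exists ord0; rewrite inE.
- by move=> x y _; exists ord0; rewrite !inE.
- by move=> x t t' _ _; rewrite (ord1 t) (ord1 t') connect0.
Defined.

Lemma packing_width_exists (H : sgraph -> Prop) :
  exists m, `[< exists D : tree_decomposition G, packing_width H D = m >].
Proof.
by exists (packing_width H trivial_decomposition); apply/asboolP; eexists.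
Qed.
End TrivialDecomposition.

Definition tree_pi (H : sgraph -> Prop) (G : sgraph) : nat :=
  ex_minn (packing_width_exists G H).

(** * Maximum weight independent sets *)

Definition independent (G : sgraph) (S : {set G}) : Prop :=
  forall x y, x \in S -> y \in S -> ~~ edge x y.

Definition weight (G : sgraph) (w : G -> rat) (S : {set G}) : rat :=
  (\sum_(x in S) w x)%R.

Definition max_weight_independent (G : sgraph) (w : G -> rat) (S : {set G}) : Prop :=
  independent S /\
  forall S' : {set G}, independent S' -> (weight w S' <= weight w S)%R.

(** * Model of computation

  Algorithms are programs of a first-order functional language on binary trees
  whose leaves are natural numbers or weights (pure Lisp; compare the language
  F in Jones, "Computability and Complexity").  A program is a fixed finite
  list of mutually recursive functions of one argument.  Evaluation is by value
  and every evaluation rule costs one unit.  Representing trees by pointers,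
  each rule takes a constant number of operations of a random access machine
  with unit-cost addition, truncated subtraction and comparison of numbers and
  unit-cost addition and comparison of weights.  There is no multiplication
  and no deep equality test, so a number produced in t steps has O(t) bits more
  than the numbers in the input and the program, and the model is
  polynomially equivalent to Turing machines (on inputs without weights). *)

Inductive value : Type :=
| Num of nat
| Wgt of rat
| Cons of value & value.

Inductive op1 : Type := Fst | Snd | IsCons.
Inductive op2 : Type := MkCons | Add | Sub | Leq.

Definition op1_sem (o : op1) (v : value) : option value :=
  match o, v with
  | Fst, Cons a _ => Some a
  | Snd, Cons _ b => Some b
  | IsCons, Cons _ _ => Some (Num 1)
  | IsCons, _ => Some (Num 0)
  | _, _ => None
  end.

Definition op2_sem (o : op2) (v1 v2 : value) : option value :=
  match o, v1, v2 with
  | MkCons, _, _ => Some (Cons v1 v2)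
  | Add, Num m, Num n => Some (Num (m + n))
  | Add, Wgt a, Wgt b => Some (Wgt (a + b)%R)
  | Sub, Num m, Num n => Some (Num (m - n))
  | Leq, Num m, Num n => Some (Num (m <= n))
  | Leq, Wgt a, Wgt b => Some (Num (a <= b)%R)
  | _, _, _ => None
  end.

(* Variables are de Bruijn indices; [Let e1 e2] binds the index 0 in [e2]. *)
Inductive expr : Type :=
| Var of nat
| Const of value
| Op1 of op1 & expr
| Op2 of op2 & expr & expr
| Let of expr & expr
| If of expr & expr & expr
| Call of nat & expr.

Definition program := seq expr.

(* [eval p env e v t]: under the definitions [p] and the environment [env],
   the expression [e] evaluates to [v] in [t] steps.  Ill-formed operations
   are stuck: they have no value. *)
Inductive eval (p : program) : seq value -> expr -> value -> nat -> Prop :=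
| EvalVar env i v :
    onth env i = Some v -> eval p env (Var i) v 1
| EvalConst env v :
    eval p env (Const v) v 1
| EvalOp1 env o e v r t :
    eval p env e v t -> op1_sem o v = Some r ->
    eval p env (Op1 o e) r t.+1
| EvalOp2 env o e1 e2 v1 v2 r t1 t2 :
    eval p env e1 v1 t1 -> eval p env e2 v2 t2 -> op2_sem o v1 v2 = Some r ->
    eval p env (Op2 o e1 e2) r (t1 + t2).+1
| EvalLet env e1 e2 v1 v2 t1 t2 :
    eval p env e1 v1 t1 -> eval p (v1 :: env) e2 v2 t2 ->
    eval p env (Let e1 e2) v2 (t1 + t2).+1
| EvalIf env e e1 e2 m v t t' :
    eval p env e (Num m) t -> eval p env (if m == 0 then e2 else e1) v t' ->
    eval p env (If e e1 e2) v (t + t').+1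
| EvalCall env f e body a v t t' :
    eval p env e a t -> onth p f = Some body -> eval p [:: a] body v t' ->
    eval p env (Call f e) v (t + t').+1.

Lemma eval_det (p : program) env e v1 v2 t1 t2 :
  eval p env e v1 t1 -> eval p env e v2 t2 -> v1 = v2 /\ t1 = t2.
Proof.
move=> ev1; elim: ev1 v2 t2 => {env e v1 t1}; intros;
  match goal with H : eval _ _ _ ?v ?t |- _ = ?v /\ _ = ?t => inversion H; clear H; subst end;
  repeat match goal with
  | E : Some _ = Some _ |- _ => injection E as E; subst
  | E : Num _ = Num _ |- _ => injection E as E; subst
  | E : ?x = Some _, E' : ?x = Some _ |- _ => rewrite E in E'
  | IH : (forall v t, eval _ ?env ?e v t -> _), H : eval _ ?env ?e _ _ |- _ =>
      destruct (IH _ _ H); clear IH H; subst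
  end; by split.
Qed.

(* The function number 0 is the entry point. *)
Definition run (p : program) (input output : value) (t : nat) : Prop :=
  eval p [:: input] (Call 0 (Var 0)) output t.

(** * Encoding of instances and answers *)

Definition encode_seq (A : Type) (f : A -> value) (s : seq A) : value :=
  foldr (fun x => Cons (f x)) (Num 0) s.

Definition encode_vertex (G : sgraph) (x : G) : value := Num (enum_rank x).

(* A vertex-weighted graph is given by the list, in the order of the numbering
   of its vertices, of the pairs of a weight and an adjacency list. *)
Definition encode_graph (G : sgraph) (w : G -> rat) : value :=
  encode_seq
    (fun x => Cons (Wgt (w x)) (encode_seq (@encode_vertex G) [seq y <- enum G | edge x y]))
    (enum G).

Definition answer_report : value := Num 0.

Definition answer_solution (G : sgraph) (s : seq G) : value :=
  Cons (Num 1) (encode_seq (@encode_vertex G) s).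

(** * Time bounds *)

(* [T n] is n^(O(log^2 n)).  The integer part of the binary logarithm is within
   a factor 2 of the logarithm for n >= 2, which is absorbed by [c]. *)
Definition npow_O_log2 (T : nat -> nat) : Prop :=
  exists c N, forall n, N <= n -> T n <= n ^ (c * trunc_log 2 n ^ 2).

(* Main.v *)
Require Import Defs.
From HB Require Import structures.
From mathcomp Require Import all_boot all_order all_algebra.
From mathcomp Require Import boolp.
From mathcomp Require Import zify.
Import Defs.
Import Order.TTheory GRing.Theory Num.Theory.

Set Implicit Arguments.
Unset Strict Implicit.
Unset Printing Implicit Defensive.

(** A rooted packing of members of [H] can be extracted from a rooted packing of
  induced four-vertex paths, so if tree-pi is at most [k], then every bag [B] meets
  at most [k] pairwise anticomplete induced P4s, and every vertex set [U] has a bag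
  [B] such that each connected part of [U] outside [B] contains at most half of [U].

  The algorithm does not know [B].  It maintains a list [Ps] of induced P4s of the
  current vertex set [U] containing all those that meet [B].  If some vertex [u]
  dominates a [1/c] fraction of [Ps], it branches on whether [u] is in the solution;
  if so, [Ps] shrinks by a constant factor.  Otherwise it guesses the [4k] vertices
  of a maximal packing of P4s meeting [B]: the sublist of the P4s dominated by these
  vertices still contains all P4s meeting [B], and it is smaller by a constant factor
  because no vertex dominates many of them.  So [n^O(log n)] branches lead to empty
  lists.  Then no P4 of [U] meets [B].  A vertex [b] in no induced P4 splits [U] into
  disjoint pieces, namely the non-neighbours of [b] and the co-components of the
  neighbourhood of [b], whose optima combine to an optimum of [U].  Splitting by such
  vertices and by connected components ends in pieces of half the size, unless a large
  connected piece has no such vertex, which then misses [B].  Recursion depth [log n]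
  gives [n^O(log^2 n)].  Every answer other than failure is an exact optimum whatever
  was guessed, and failure is impossible when tree-pi is at most [k]. *)

(** Why the pieces around a vertex [b] on no P4 recombine: let D be its non-neighbours. A neighbour
    of [b] is complete or anticomplete to each component of D, and two non-adjacent neighbours see
    the same vertices of D; otherwise [b] would lie on a P4. So all vertices of a co-component of
    N(b) see the same components of D, and deleting these from an optimum of D leaves an optimum of
    the rest. One recursive call on D therefore serves every co-component, whereas separate calls on
    the parts of D would overlap and destroy the linear bound on the number of pieces.

    Excluding a heavy vertex need not shrink the list of P4s, but it removes a vertex from [U]. At
    most n exclusions happen between two reductions of the list, so a reduction by a constant factor
    multiplies the number of branches only by a polynomial in n.

    The bag is never computed. It serves only to prove that some guess succeeds, and each recursion
    level may use another bag of the same decomposition of [G], so that no decomposition of a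
    subgraph has to be constructed. *)

Notation fst_ e := (Op1 Fst e).
Notation snd_ e := (Op1 Snd e).
Notation isc_ e := (Op1 IsCons e).
Notation cons_ a b := (Op2 MkCons a b).
Notation add_ a b := (Op2 Add a b).
Notation sub_ a b := (Op2 Sub a b).
Notation leq_ a b := (Op2 Leq a b).
Notation num n := (Const (Num n)).
Notation not_ a := (If a (num 0) (num 1)).
Notation and_ a b := (If a b (num 0)).
Notation eq_ a b := (and_ (leq_ a b) (leq_ b a)).

(** * Evaluation with upper bounds on the cost *)

Definition runs (p : program) env e v T := exists2 t, eval p env e v t & t <= T.

Section Rules.
Variable p : program.
Implicit Types (env : seq value) (e : expr) (v : value).

Lemma runs_le env e v T T' : runs p env e v T -> T <= T' -> runs p env e v T'.
Proof. by case=> t ev le1 le2; exists t => //; apply: leq_trans le2. Qed.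

Lemma runs_var env i v : onth env i = Some v -> runs p env (Var i) v 1.
Proof. by move=> h; exists 1 => //; apply: EvalVar. Qed.

Lemma runs_const env v : runs p env (Const v) v 1.
Proof. by exists 1 => //; apply: EvalConst. Qed.

Lemma runs_op1 env o e v r T :
  runs p env e v T -> op1_sem o v = Some r -> runs p env (Op1 o e) r T.+1.
Proof. by case=> t ev le h; exists t.+1 => //; apply: EvalOp1 ev h. Qed.

Lemma runs_op2 env o e1 e2 v1 v2 r T1 T2 :
  runs p env e1 v1 T1 -> runs p env e2 v2 T2 -> op2_sem o v1 v2 = Some r ->
  runs p env (Op2 o e1 e2) r (T1 + T2).+1.
Proof.
case=> t1 ev1 le1 [t2 ev2 le2] h; exists (t1 + t2).+1; last by rewrite ltnS leq_add.
exact: EvalOp2 ev1 ev2 h.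
Qed.

Lemma runs_let env e1 e2 v1 v2 T1 T2 :
  runs p env e1 v1 T1 -> runs p (v1 :: env) e2 v2 T2 ->
  runs p env (Let e1 e2) v2 (T1 + T2).+1.
Proof.
case=> t1 ev1 le1 [t2 ev2 le2]; exists (t1 + t2).+1; last by rewrite ltnS leq_add.
exact: EvalLet ev1 ev2.
Qed.

(** Only the branch that is taken has to run, so the other one may be stuck. *)
Lemma runs_if env e e1 e2 (b : bool) v T T' :
  runs p env e (Num b) T ->
  (b -> runs p env e1 v T') -> (~~ b -> runs p env e2 v T') ->
  runs p env (If e e1 e2) v (T + T').+1.
Proof.
case=> t ev le h1 h2.
have [t' ev' le'] : runs p env (if nat_of_bool b == 0 then e2 else e1) v T'.
  by case: b h1 h2 {ev} => [h _|_ h]; apply: h.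
by exists (t + t').+1; [apply: EvalIf ev ev' | rewrite ltnS leq_add].
Qed.

Lemma runs_call env f e body a v T T' :
  onth p f = Some body -> runs p env e a T -> runs p [:: a] body v T' ->
  runs p env (Call f e) v (T + T').+1.
Proof.
move=> h [t ev le] [t' ev' le']; exists (t + t').+1; last by rewrite ltnS leq_add.
exact: EvalCall ev h ev'.
Qed.

Lemma runs_not env e (b : bool) T :
  runs p env e (Num b) T -> runs p env (not_ e) (Num (~~ b)) (T + 1).+1.
Proof.
move=> h; apply: runs_if h _ _ => [->|/negbTE->]; exact: runs_const.
Qed.

(** The bound for [e2] is a successor so that it also covers the constant evaluated in the false
    case. *)
Lemma runs_and env e1 e2 (b1 b2 : bool) T1 T2 :
  runs p env e1 (Num b1) T1 -> (b1 -> runs p env e2 (Num b2) T2.+1) ->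
  runs p env (and_ e1 e2) (Num (b1 && b2)) (T1 + T2.+1).+1.
Proof.
move=> h1 h2; apply: runs_if h1 _ _ => [b1T|/negbTE->] /=.
  by rewrite b1T; exact: h2.
by apply: runs_le (runs_const _ _) _.
Qed.

Ltac ev := first
  [ eassumption
  | eapply runs_var; reflexivity
  | eapply runs_const
  | eapply runs_op1; [ ev | reflexivity ]
  | eapply runs_op2; [ ev | ev | reflexivity ] ].

Lemma runs_eq env e1 e2 (m n : nat) T1 T2 :
  runs p env e1 (Num m) T1 -> runs p env e2 (Num n) T2 ->
  runs p env (eq_ e1 e2) (Num (m == n)) (2 * (T1 + T2) + 3).
Proof.
move=> h1 h2; rewrite eqn_leq.
apply: (@runs_le _ _ _ ((T1 + T2).+1 + (T2 + T1).+1).+1); last by lia.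
by apply: runs_and => [|_]; ev.
Qed.

End Rules.

Ltac ev := first
  [ eassumption
  | eapply runs_var; reflexivity
  | eapply runs_const
  | eapply runs_op1; [ ev | reflexivity ]
  | eapply runs_op2; [ ev | ev | reflexivity ] ].

Lemma leq_expl m n e : m <= n -> m ^ e <= n ^ e.
Proof. by case: e => // e le; rewrite leq_exp2r. Qed.

(* [lia] separates occurrences of [size s] that differ by the canonical structure
   inferred for the type of the elements. *)
Ltac slia :=
  repeat match goal with
  | H : is_true (leq _ _) |- _ => generalize H; clear H
  end;
  repeat match goal with
  | |- context [@size ?T ?s] =>
      let n := fresh "n" in set n := (@size T s); clearbody n
  end; lia.

(** * Encoded lists *)

Section Lists.
Variable p : program.

Lemma isc_encode_seq (A : Type) (f : A -> value) (s : seq A) :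
  op1_sem IsCons (encode_seq f s) = Some (Num (0 < size s)).
Proof. by case: s. Qed.

Lemma runs_isc (A : Type) (f : A -> value) (s : seq A) env e T :
  runs p env e (encode_seq f s) T -> runs p env (isc_ e) (Num (0 < size s)) T.+1.
Proof. by move=> h; apply: runs_op1 h _; rewrite isc_encode_seq. Qed.

Lemma runs_has (A : Type) (f : A -> value) (a : pred A) (s : seq A) env e T :
  runs p env e (encode_seq f (filter a s)) T -> runs p env (isc_ e) (Num (has a s)) T.+1.
Proof. by move=> /runs_isc; rewrite size_filter -has_count. Qed.

(* The test of a filter sees the current element as variable 0 and the
   context as variable 1. *)
Definition filter_body (self : nat) (test : expr) : expr :=
  If (isc_ (snd_ (Var 0)))
    (Let (fst_ (Var 0))
      (Let (fst_ (snd_ (Var 1)))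
        (If test
          (cons_ (Var 0) (Call self (cons_ (Var 1) (snd_ (snd_ (Var 2))))))
          (Call self (cons_ (Var 1) (snd_ (snd_ (Var 2))))))))
    (num 0).

(** The test need only run on elements of [s]: the P4 test, for instance, is stuck on lists that are
    too short. The third variable [z] is the whole argument, which changes with every recursive
    call, hence the quantifier. *)
Lemma runs_filter (A : eqType) (enc : A -> value) (a : pred A) self test ctx T env e
    (s : seq A) T0 :
  onth p self = Some (filter_body self test) ->
  {in s, forall x z, runs p [:: enc x; ctx; z] test (Num (a x)) T} ->
  runs p env e (Cons ctx (encode_seq enc s)) T0 ->
  runs p env (Call self e) (encode_seq enc (filter a s)) (T0 + (T + 30) * (size s).+1).
Proof.
move=> hself; elim: s env e T0 => [|x s IHs] env e T0 htest he.
  apply: runs_le; first (apply: runs_call hself he _; apply: (@runs_if _ _ _ _ _ false) => //).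
  - by ev.
  - by move=> _; ev.
  by lia.
apply: runs_le; first (apply: runs_call hself he _; apply: (@runs_if _ _ _ _ _ true) => //).
- by ev.
- move=> _; eapply runs_let; first by ev.
  eapply runs_let; first by ev.
  have hs : {in s, forall x z, runs p [:: enc x; ctx; z] test (Num (a x)) T}.
    by move=> y ys z; apply: htest; rewrite inE ys orbT.
  apply: runs_if => [|ax|/negbTE ax].
  + by apply: htest; rewrite inE eqxx.
  + rewrite /= ax; eapply runs_op2; [by ev | | reflexivity].
    by apply: IHs => //; ev.
  + rewrite /= ax; apply: runs_le; first (apply: IHs => //; by ev).
    by rewrite -[X in X <= _]add0n leqW // leq_add.
by move=> /=; lia.
Qed.

Definition length_body (self : nat) : expr :=
  If (isc_ (Var 0)) (add_ (num 1) (Call self (snd_ (Var 0)))) (num 0).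

Lemma runs_length (A : Type) (enc : A -> value) self env e (s : seq A) T0 :
  onth p self = Some (length_body self) ->
  runs p env e (encode_seq enc s) T0 ->
  runs p env (Call self e) (Num (size s)) (T0 + 20 * (size s).+1).
Proof.
move=> hself; elim: s env e T0 => [|x s IHs] env e T0 he.
  apply: runs_le; first (apply: runs_call hself he _; apply: (@runs_if _ _ _ _ _ false) => //).
  - by ev.
  - by move=> _; ev.
  by lia.
apply: runs_le; first (apply: runs_call hself he _; apply: (@runs_if _ _ _ _ _ true) => //).
- by ev.
- by move=> _; eapply runs_op2; [ev | apply: IHs; ev | reflexivity].
by move=> /=; lia.
Qed.

Definition append_body (self : nat) : expr :=
  If (isc_ (fst_ (Var 0)))
    (cons_ (fst_ (fst_ (Var 0)))
       (Call self (cons_ (snd_ (fst_ (Var 0))) (snd_ (Var 0)))))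
    (snd_ (Var 0)).

Lemma runs_append (A : Type) (enc : A -> value) self env e (s1 s2 : seq A) T0 :
  onth p self = Some (append_body self) ->
  runs p env e (Cons (encode_seq enc s1) (encode_seq enc s2)) T0 ->
  runs p env (Call self e) (encode_seq enc (s1 ++ s2)) (T0 + 30 * (size s1).+1).
Proof.
move=> hself; elim: s1 env e T0 => [|x s IHs] env e T0 he.
  apply: runs_le; first (apply: runs_call hself he _; apply: (@runs_if _ _ _ _ _ false) => //).
  - by ev.
  - by move=> _; ev.
  by lia.
apply: runs_le; first (apply: runs_call hself he _; apply: (@runs_if _ _ _ _ _ true) => //).
- by ev.
- move=> _; eapply runs_op2; [by ev | | reflexivity].
  by apply: IHs; ev.
by move=> /=; lia.
Qed.

Definition nth_body (self : nat) : expr :=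
  If (leq_ (num 1) (snd_ (Var 0)))
    (Call self (cons_ (snd_ (fst_ (Var 0))) (sub_ (snd_ (Var 0)) (num 1))))
    (fst_ (fst_ (Var 0))).

Lemma runs_nth (A : Type) (enc : A -> value) self env e (s : seq A) x0 i T0 :
  onth p self = Some (nth_body self) -> i < size s ->
  runs p env e (Cons (encode_seq enc s) (Num i)) T0 ->
  runs p env (Call self e) (enc (nth x0 s i)) (T0 + 30 * i.+1).
Proof.
move=> hself; elim: i s env e T0 => [|i IHi] [//|x s] env e T0 hi he.
  apply: runs_le; first (apply: runs_call hself he _; apply: (@runs_if _ _ _ _ _ false) => //).
  - by ev.
  - by move=> _; ev.
  by lia.
apply: runs_le; first (apply: runs_call hself he _; apply: (@runs_if _ _ _ _ _ true) => //).
- by ev.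
- have E : Num i = Num (i.+1 - 1) by rewrite subn1.
  by move=> _ /=; apply: IHi => //; rewrite E; ev.
by move=> /=; lia.
Qed.

Definition map_cons_body (self : nat) : expr :=
  If (isc_ (fst_ (snd_ (Var 0))))
    (cons_ (cons_ (fst_ (Var 0)) (fst_ (fst_ (snd_ (Var 0)))))
       (Call self (cons_ (fst_ (Var 0))
          (cons_ (snd_ (fst_ (snd_ (Var 0)))) (snd_ (snd_ (Var 0)))))))
    (snd_ (snd_ (Var 0))).

Lemma runs_map_cons (A : Type) (enc : A -> value) self env e (x : A) (ts acc : seq (seq A)) T0 :
  onth p self = Some (map_cons_body self) ->
  runs p env e (Cons (enc x)
     (Cons (encode_seq (encode_seq enc) ts) (encode_seq (encode_seq enc) acc))) T0 ->
  runs p env (Call self e) (encode_seq (encode_seq enc) ([seq x :: t | t <- ts] ++ acc))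
    (T0 + 60 * (size ts).+1).
Proof.
move=> hself; elim: ts env e T0 => [|t ts IHs] env e T0 he.
  apply: runs_le; first (apply: runs_call hself he _; apply: (@runs_if _ _ _ _ _ false) => //).
  - by ev.
  - by move=> _; ev.
  by lia.
apply: runs_le; first (apply: runs_call hself he _; apply: (@runs_if _ _ _ _ _ true) => //).
- by ev.
- move=> _ /=; eapply runs_op2; [by ev | | reflexivity].
  by apply: IHs; ev.
by move=> /=; lia.
Qed.

Definition pairs_body (self f_map_cons : nat) : expr :=
  If (isc_ (fst_ (Var 0)))
    (Call f_map_cons (cons_ (fst_ (fst_ (Var 0)))
       (cons_ (snd_ (Var 0))
          (Call self (cons_ (snd_ (fst_ (Var 0))) (snd_ (Var 0)))))))
    (num 0).

Lemma runs_pairs (A : Type) (enc : A -> value) self f_map_cons env e (s : seq A)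
    (ts : seq (seq A)) T0 :
  onth p self = Some (pairs_body self f_map_cons) ->
  onth p f_map_cons = Some (map_cons_body f_map_cons) ->
  runs p env e (Cons (encode_seq enc s) (encode_seq (encode_seq enc) ts)) T0 ->
  runs p env (Call self e) (encode_seq (encode_seq enc) [seq x :: t | x <- s, t <- ts])
    (T0 + (60 * (size ts).+1 + 40) * (size s).+1).
Proof.
move=> hself hmc; elim: s env e T0 => [|x s IHs] env e T0 he.
  apply: runs_le; first (apply: runs_call hself he _; apply: (@runs_if _ _ _ _ _ false) => //).
  - by ev.
  - by move=> _; ev.
  by lia.
apply: runs_le; first (apply: runs_call hself he _; apply: (@runs_if _ _ _ _ _ true) => //).
- by ev.
- move=> _ /=; apply: runs_map_cons => //; eapply runs_op2; [by ev | | reflexivity].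
  eapply runs_op2; [by ev | | reflexivity].
  by apply: IHs; ev.
by move=> /=; lia.
Qed.

Fixpoint tuples (A : Type) (s : seq A) (n : nat) : seq (seq A) :=
  if n is m.+1 then [seq x :: t | x <- s, t <- tuples s m] else [:: [::]].

Lemma size_tuples (A : Type) (s : seq A) n : size (tuples s n) = size s ^ n.
Proof. by elim: n => //= n IHn; rewrite size_allpairs IHn expnS. Qed.

Lemma tuplesP (A : eqType) (s : seq A) n t :
  reflect (size t = n /\ {subset t <= s}) (t \in tuples s n).
Proof.
elim: n t => [|n IHn] t /=.
  rewrite inE; apply: (iffP eqP) => [->|[/size0nil ->]] //.
apply: (iffP allpairsP) => [[[x u] /= [xs /IHn[su us] ->]]|[]].
  by split=> [|y]; rewrite /= ?su // inE => /orP[/eqP->|/us].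
case: t => // x u [su] us; exists (x, u) => /=; split => //.
  by apply: us; rewrite inE eqxx.
by apply/IHn; split=> // y yu; apply: us; rewrite inE yu orbT.
Qed.

Definition tuples_body (self f_pairs : nat) : expr :=
  If (leq_ (num 1) (snd_ (Var 0)))
    (Call f_pairs (cons_ (fst_ (Var 0))
       (Call self (cons_ (fst_ (Var 0)) (sub_ (snd_ (Var 0)) (num 1))))))
    (cons_ (num 0) (num 0)).

Lemma runs_tuples (A : Type) (enc : A -> value) self f_pairs f_map_cons env e (s : seq A)
    n b T0 :
  onth p self = Some (tuples_body self f_pairs) ->
  onth p f_pairs = Some (pairs_body f_pairs f_map_cons) ->
  onth p f_map_cons = Some (map_cons_body f_map_cons) ->
  size s < b ->
  runs p env e (Cons (encode_seq enc s) (Num n)) T0 ->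
  runs p env (Call self e) (encode_seq (encode_seq enc) (tuples s n))
    (T0 + 200 * n.+1 * b ^ n.+1).
Proof.
move=> hself hp hmc sb; have b0 : 0 < b by apply: leq_trans sb.
elim: n env e T0 => [|n IHn] env e T0 he.
  apply: runs_le; first (apply: runs_call hself he _; apply: (@runs_if _ _ _ _ _ false) => //).
  - by ev.
  - by move=> _; ev.
  by lia.
apply: runs_le; first (apply: runs_call hself he _; apply: (@runs_if _ _ _ _ _ true) => //).
- by ev.
- have E : Num n = Num (n.+1 - 1) by rewrite subn1.
  move=> _ /=; apply: (runs_pairs hp hmc); eapply runs_op2; [by ev | | reflexivity].
  by apply: IHn; rewrite E; ev.
rewrite size_tuples.
have h1 : size s ^ n <= b ^ n by apply: leq_expl; exact: ltnW.
have h2 : 0 < b ^ n.+1 by rewrite expn_gt0 b0.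
have h3 : b ^ n <= b ^ n.+1 by apply: leq_pexp2l.
have h4 : b ^ n.+1 <= b ^ n.+2 by apply: leq_pexp2l.
have h5 : (60 * (size s ^ n).+1 + 40) * (size s).+1 <= 160 * b ^ n.+1.
  have -> : 160 * b ^ n.+1 = (160 * b ^ n) * b by rewrite expnS; lia.
  apply: leq_mul => //; have : 0 < b ^ n by rewrite expn_gt0 b0.
  lia.
have : 200 * n.+1 * b ^ n.+1 <= 200 * n.+1 * b ^ n.+2 by rewrite leq_mul2l h4 orbT.
have -> : 200 * n.+2 * b ^ n.+2 = 200 * n.+1 * b ^ n.+2 + 200 * b ^ n.+2 by lia.
move: h1 h2 h3 h4 h5; lia.
Qed.

End Lists.

(** * The program *)

Definition f_mem := 1.
Definition f_nth := 2.
Definition f_closed_nbr := 3.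
Definition f_open_nbr := 4.
Definition f_non_nbr := 5.
Definition f_remove := 6.
Definition f_co_nbr := 7.
Definition f_near := 8.
Definition f_co_near := 9.
Definition f_component := 10.
Definition f_co_component := 11.
Definition f_diff := 12.
Definition f_length := 13.
Definition f_append := 14.
Definition f_map_cons := 15.
Definition f_pairs := 16.
Definition f_tuples := 17.
Definition f_p4 := 18.
Definition f_contain := 19.
Definition f_avoid := 20.
Definition f_touched := 21.
Definition f_untouched := 22.
Definition f_heavy := 23.
Definition f_p4_free := 24.
Definition f_weight := 25.
Definition f_iota := 26.
Definition f_solve := 27.
Definition f_branch := 28.
Definition f_guess := 29.
Definition f_split := 30.
Definition f_join := 31.

Notation mem_ x s := (isc_ (Call f_mem (cons_ x s))).
Notation adj_ g x y := (mem_ y (snd_ (Call f_nth (cons_ g x)))).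

Definition closed_nbr_test : expr :=
  If (eq_ (snd_ (Var 1)) (Var 0)) (num 1) (adj_ (fst_ (Var 1)) (snd_ (Var 1)) (Var 0)).

Definition co_nbr_test : expr :=
  If (eq_ (snd_ (Var 1)) (Var 0)) (num 1) (not_ (adj_ (fst_ (Var 1)) (snd_ (Var 1)) (Var 0))).

Definition near_test (f_nbr : nat) : expr :=
  isc_ (Call f_nbr (cons_ (cons_ (fst_ (Var 1)) (Var 0)) (snd_ (Var 1)))).

(* A comment [(g, ...)] before a body gives the shape of the argument: [g] is the
   encoded graph, [U] the current vertex set, [Ps] a list of induced P4s, and [s] the
   size of the vertex set that has to be halved. *)
(* [(g, (U, (C, fuel)))]: only the length of [fuel] matters *)
Definition closure_body (self f_near : nat) : expr :=
  If (isc_ (snd_ (snd_ (snd_ (Var 0)))))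
    (Call self (cons_ (fst_ (Var 0)) (cons_ (fst_ (snd_ (Var 0))) (cons_
       (Call f_near (cons_ (cons_ (fst_ (Var 0)) (fst_ (snd_ (snd_ (Var 0)))))
                           (fst_ (snd_ (Var 0)))))
       (snd_ (snd_ (snd_ (snd_ (Var 0)))))))))
    (fst_ (snd_ (snd_ (Var 0)))).

Definition p4_test : expr :=
  let g := Var 1 in
  let x0 := fst_ (Var 0) in let x1 := fst_ (snd_ (Var 0)) in
  let x2 := fst_ (snd_ (snd_ (Var 0))) in let x3 := fst_ (snd_ (snd_ (snd_ (Var 0)))) in
  and_ (adj_ g x0 x1) (and_ (adj_ g x1 x2) (and_ (adj_ g x2 x3)
    (and_ (not_ (adj_ g x0 x2)) (and_ (not_ (adj_ g x0 x3)) (not_ (adj_ g x1 x3)))))).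

Definition touched_test : expr :=
  isc_ (Call f_near (cons_ (Var 1) (Var 0))).

(** The language has no multiplication. As the factor is a constant of the program, the product is
    unrolled into additions. *)
Fixpoint mul_ (c : nat) (e : expr) : expr :=
  if c is c'.+1 then add_ e (mul_ c' e) else num 0.

Notation singleton_ e := (cons_ e (num 0)).

Definition heavy_test (c : nat) : expr :=
  Let (Call f_length (Call f_touched
         (cons_ (cons_ (fst_ (Var 1)) (singleton_ (Var 0))) (snd_ (Var 1)))))
    (leq_ (Call f_length (snd_ (Var 2))) (mul_ c (Var 0))).

Definition weight_body : expr :=
  If (isc_ (snd_ (Var 0)))
    (add_ (fst_ (Call f_nth (cons_ (fst_ (Var 0)) (fst_ (snd_ (Var 0))))))
          (Call f_weight (cons_ (fst_ (Var 0)) (snd_ (snd_ (Var 0))))))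
    (Const (Wgt 0%R)).

Definition iota_body : expr :=
  If (isc_ (fst_ (Var 0)))
    (cons_ (snd_ (Var 0))
       (Call f_iota (cons_ (snd_ (fst_ (Var 0))) (add_ (snd_ (Var 0)) (num 1)))))
    (num 0).

Definition main_body : expr :=
  Call f_solve (cons_ (Var 0) (Call f_iota (cons_ (Var 0) (num 0)))).

(** These encodings agree with [answer_report] and [answer_solution], so the value of the outermost
    call is already the answer. *)
Notation fail_ := (num 0).
Notation some_ e := (cons_ (num 1) e).
Notation p4s_ g U := (Call f_p4 (cons_ g (Call f_tuples (cons_ U (num 4))))).

(* [(g, U)] *)
Definition solve_body : expr :=
  let g := fst_ (Var 0) in let U := snd_ (Var 0) in
  If (leq_ (Call f_length U) (num 1)) (some_ U)
    (Call f_branch (cons_ g (cons_ U (cons_ (p4s_ g U) (Call f_length U))))).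

(* [(g, (U, (Ps, s)))] *)
Definition branch_body (r : nat) : expr :=
  If (isc_ (fst_ (snd_ (snd_ (Var 0)))))
    (Let (Call f_heavy (cons_ (cons_ (fst_ (Var 0)) (fst_ (snd_ (snd_ (Var 0)))))
                              (fst_ (snd_ (Var 0)))))
      (If (isc_ (Var 0))
        (Let (fst_ (Var 0))
          (let a := Var 2 in
           let g := fst_ a in let U := fst_ (snd_ a) in
           let P := fst_ (snd_ (snd_ a)) in let s := snd_ (snd_ (snd_ a)) in
           Let (Call f_branch (cons_ g (cons_ (Call f_non_nbr (cons_ (cons_ g (Var 0)) U))
                  (cons_ (Call f_untouched (cons_ (cons_ g (singleton_ (Var 0))) P)) s))))
            (If (isc_ (Var 0))
              (let a := Var 3 in
               let g := fst_ a in let U := fst_ (snd_ a) in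
               let P := fst_ (snd_ (snd_ a)) in let s := snd_ (snd_ (snd_ a)) in
               Let (Call f_branch (cons_ g (cons_ (Call f_remove (cons_ (Var 1) U))
                      (cons_ (Call f_avoid (cons_ (Var 1) P)) s))))
                (If (isc_ (Var 0))
                  (Let (cons_ (Var 2) (snd_ (Var 1)))
                    (If (leq_ (Call f_weight (cons_ (fst_ (Var 5)) (Var 0)))
                              (Call f_weight (cons_ (fst_ (Var 5)) (snd_ (Var 1)))))
                      (Var 1) (some_ (Var 0))))
                  fail_))
              fail_)))
        (Call f_guess (cons_ (Call f_tuples (cons_ (fst_ (snd_ (Var 1))) (num r))) (Var 1)))))
    (Call f_split (cons_ (fst_ (Var 0))
       (cons_ (fst_ (snd_ (Var 0))) (snd_ (snd_ (snd_ (Var 0))))))).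

(* [(Xs, (g, (U, (Ps, s))))] *)
Definition guess_body : expr :=
  let g := fst_ (snd_ (Var 0)) in let U := fst_ (snd_ (snd_ (Var 0))) in
  let P := fst_ (snd_ (snd_ (snd_ (Var 0)))) in
  let s := snd_ (snd_ (snd_ (snd_ (Var 0)))) in
  If (isc_ (fst_ (Var 0)))
    (Let (Call f_branch (cons_ g (cons_ U (cons_
            (Call f_touched (cons_ (cons_ g (fst_ (fst_ (Var 0)))) P)) s))))
      (If (isc_ (Var 0)) (Var 0)
        (Call f_guess (cons_ (snd_ (fst_ (Var 1))) (snd_ (Var 1))))))
    fail_.

(* [(g, (U, s))] *)
Definition split_body : expr :=
  let g i := fst_ (Var i) in let U i := fst_ (snd_ (Var i)) in
  let s i := snd_ (snd_ (Var i)) in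
  If (leq_ (add_ (Call f_length (U 0)) (Call f_length (U 0))) (s 0))
    (Call f_solve (cons_ (g 0) (U 0)))
    (Let (Call f_component (cons_ (g 0) (cons_ (U 0) (cons_ (singleton_ (fst_ (U 0))) (U 0)))))
    (Let (Call f_diff (cons_ (Var 0) (U 1)))
      (If (isc_ (Var 0))
        (Let (Call f_split (cons_ (g 2) (cons_ (Var 1) (s 2))))
          (If (isc_ (Var 0))
            (Let (Call f_split (cons_ (g 3) (cons_ (Var 1) (s 3))))
              (If (isc_ (Var 0))
                (some_ (Call f_append (cons_ (snd_ (Var 1)) (snd_ (Var 0)))))
                fail_))
            fail_))
        (Let (Call f_p4_free (cons_ (p4s_ (g 2) (U 2)) (U 2)))
          (If (isc_ (Var 0))
            (Let (fst_ (Var 0))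
            (Let (Call f_split (cons_ (g 4)
                    (cons_ (Call f_non_nbr (cons_ (cons_ (g 4) (Var 0)) (U 4))) (s 4))))
              (If (isc_ (Var 0))
                (Call f_join
                  (cons_ (Call f_open_nbr (cons_ (cons_ (g 5) (Var 1)) (U 5)))
                  (cons_ (snd_ (Var 0)) (cons_ (cons_ (Var 1) (snd_ (Var 0)))
                  (cons_ (g 5) (s 5))))))
                fail_)))
            fail_))))).

(* [(A, (D, (best, (g, s))))] *)
Definition join_body : expr :=
  let A i := fst_ (Var i) in let D i := fst_ (snd_ (Var i)) in
  let best i := fst_ (snd_ (snd_ (Var i))) in
  let g i := fst_ (snd_ (snd_ (snd_ (Var i)))) in
  let s i := snd_ (snd_ (snd_ (snd_ (Var i)))) in
  If (isc_ (A 0))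
    (Let (Call f_co_component (cons_ (g 0) (cons_ (A 0) (cons_ (singleton_ (fst_ (A 0))) (A 0)))))
    (Let (Call f_split (cons_ (g 1) (cons_ (Var 0) (s 1))))
      (If (isc_ (Var 0))
        (Let (Call f_append (cons_ (snd_ (Var 0))
                (Call f_non_nbr (cons_ (cons_ (g 2) (fst_ (A 2))) (D 2)))))
        (Let (If (leq_ (Call f_weight (cons_ (g 3) (best 3)))
                       (Call f_weight (cons_ (g 3) (Var 0)))) (Var 0) (best 3))
          (Call f_join (cons_ (Call f_diff (cons_ (Var 3) (A 4)))
             (cons_ (D 4) (cons_ (Var 0) (cons_ (g 4) (s 4))))))))
        fail_)))
    (some_ (best 0)).

(** The position of each body is the index fixed by the corresponding [f_] constant. The threshold
    [c] and the number [r] of guessed vertices are written into the code; they depend on [k]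
    only. *)
Definition mis_program (c r : nat) : program :=
  [:: main_body;
      filter_body f_mem (eq_ (Var 0) (Var 1));
      nth_body f_nth;
      filter_body f_closed_nbr closed_nbr_test;
      filter_body f_open_nbr (adj_ (fst_ (Var 1)) (snd_ (Var 1)) (Var 0));
      filter_body f_non_nbr (not_ closed_nbr_test);
      filter_body f_remove (not_ (eq_ (Var 0) (Var 1)));
      filter_body f_co_nbr co_nbr_test;
      filter_body f_near (near_test f_closed_nbr);
      filter_body f_co_near (near_test f_co_nbr);
      closure_body f_component f_near;
      closure_body f_co_component f_co_near;
      filter_body f_diff (not_ (mem_ (Var 0) (Var 1)));
      length_body f_length;
      append_body f_append;
      map_cons_body f_map_cons;
      pairs_body f_pairs f_map_cons;
      tuples_body f_tuples f_pairs;
      filter_body f_p4 p4_test;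
      filter_body f_contain (mem_ (Var 1) (Var 0));
      filter_body f_avoid (not_ (mem_ (Var 1) (Var 0)));
      filter_body f_touched touched_test;
      filter_body f_untouched (not_ touched_test);
      filter_body f_heavy (heavy_test c);
      filter_body f_p4_free (not_ (isc_ (Call f_contain (cons_ (Var 0) (Var 1)))));
      weight_body;
      iota_body;
      solve_body;
      branch_body r;
      guess_body;
      split_body;
      join_body].

(** * Graph notions computed by the auxiliary functions *)

Section GraphOps.
Variable G : sgraph.
Implicit Types (x y : G) (U C X : seq G) (P : seq G) (Ps : seq (seq G)).

Definition closed_nbr x y := (x == y) || edge x y.
Definition co_nbr x y := (x == y) || ~~ edge x y.
(* The argument order is that of the test of the filter [f_near]. *)
Definition near (R : rel G) C y := has (R y) C.
(** For a reflexive [R] the iteration increases when it starts inside [U]. From one vertex of [U],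
    with [n] at least the size of [U], it yields the component of that vertex for [closed_nbr] and
    its co-component for [co_nbr]. *)
Definition saturate (R : rel G) U C n := iter n (fun C => filter (near R C) U) C.

Definition is_p4 P :=
  if P is [:: x0; x1; x2; x3]
  then [&& edge x0 x1, edge x1 x2, edge x2 x3,
           ~~ edge x0 x2, ~~ edge x0 x3 & ~~ edge x1 x3]
  else false.

Definition p4s U := filter is_p4 (tuples U 4).
Definition touched X P := has (near closed_nbr X) P.
Definition p4_free Ps x := ~~ has (fun P => x \in P) Ps.
Definition heavy (c : nat) Ps x := size Ps <= c * size (filter (touched [:: x]) Ps).

End GraphOps.

(** * Running times of the auxiliary functions *)

Section Helpers.
Variables (c r b : nat) (G : sgraph) (w : G -> rat).
(** All costs are bounded by powers of [b]. The summand 1000 lets one further factor [b] absorb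
    every numerical constant, so only exponents have to be tracked. *)
Hypothesis hb : #|G| + r + c + 1000 <= b.
Let p := mis_program c r.
Let encg := encode_graph w.
Notation encv := (@encode_vertex G).
Notation encl := (encode_seq (@encode_vertex G)).
Notation encll := (encode_seq (encode_seq (@encode_vertex G))).

Lemma leq_filter_cost T m i j :
  T <= b ^ i -> m <= b ^ j -> (T + 30) * m <= b ^ (i + j).+1.
Proof.
move=> hT hm; rewrite -addSn expnD; apply: leq_mul => //.
have : 0 < b ^ i by rewrite expn_gt0; apply/orP; left; slia.
have : 1000 * b ^ i <= b ^ i.+1 by rewrite expnS leq_mul2r; apply/orP; right; slia.
slia.
Qed.

Lemma b_pow i : 1000 * b ^ i <= b ^ i.+1.
Proof. by rewrite expnS leq_mul2r; apply/orP; right; slia. Qed.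

Lemma b_gt0 i : 0 < b ^ i.
Proof. by rewrite expn_gt0; apply/orP; left; slia. Qed.

Lemma b_pow2 : 1000 * b <= b ^ 2. Proof. by have := b_pow 1; rewrite expn1. Qed.

Lemma eqE_rank (x y : G) : (enum_rank x == enum_rank y :> nat) = (x == y).
Proof. by rewrite (inj_eq val_inj) (inj_eq enum_rank_inj). Qed.

Lemma runs_eqv env e1 e2 (x y : G) T1 T2 :
  runs p env e1 (encv x) T1 -> runs p env e2 (encv y) T2 ->
  runs p env (eq_ e1 e2) (Num (x == y)) (2 * (T1 + T2) + 3).
Proof. by move=> h1 h2; rewrite -eqE_rank; apply: runs_eq. Qed.

Lemma runs_mem env e1 e2 (x : G) (s : seq G) T1 T2 :
  runs p env e1 (encv x) T1 -> runs p env e2 (encl s) T2 ->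
  runs p env (mem_ e1 e2) (Num (x \in s)) (T1 + T2 + 40 * (size s).+1 + 2).
Proof.
move=> h1 h2; rewrite -has_pred1.
apply: runs_le; first (apply: runs_has; apply: (@runs_filter p _ encv (pred1 x) _ _ (encv x) 7) => //).
- by move=> z _ y /=; apply: (@runs_eqv _ _ _ _ _ 1 1); ev.
- by ev.
by slia.
Qed.

Lemma runs_adj env g x y (u v : G) T1 T2 T3 :
  runs p env g encg T1 -> runs p env x (encv u) T2 -> runs p env y (encv v) T3 ->
  runs p env (adj_ g x y) (Num (edge u v)) (T1 + T2 + T3 + 100 * b).
Proof.
move=> h1 h2 h3.
have -> : edge u v = (v \in [seq z <- enum G | edge u z]) by rewrite mem_filter mem_enum andbT.
have hi : enum_rank u < size (enum G) by rewrite -cardE ltn_ord.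
have hn : enum_rank u < #|G| by [].
apply: runs_le; first (apply: runs_mem => //; first exact: h3).
- eapply runs_op1.
    apply: (@runs_nth p _ _ f_nth _ _ _ u _ _ erefl hi); ev.
  by rewrite nth_enum_rank.
have : size [seq z <- enum G | edge u z] <= #|G|.
  by rewrite cardE size_filter count_size.
by move: hb; slia.
Qed.

(** The bound [#|G| + r + 4] covers every kind of vertex list that occurs: duplicate-free vertex
    lists, guessed tuples of length [r], and P4s. *)
Lemma runs_vfilter self test ctx (a : pred G) env e (s : seq G) T0 i :
  onth p self = Some (filter_body self test) ->
  (forall x z, runs p [:: encv x; ctx; z] test (Num (a x)) (b ^ i)) ->
  size s <= #|G| + r + 4 ->
  runs p env e (Cons ctx (encl s)) T0 ->
  runs p env (Call self e) (encl (filter a s)) (T0 + b ^ i.+2).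
Proof.
move=> h1 h2 hs h3; apply: runs_le; first (apply: runs_filter h1 _ h3 => x _; exact: h2).
rewrite leq_add2l -(addn1 i); apply: leq_filter_cost => //.
by rewrite expn1; move: hb; slia.
Qed.

Lemma closed_nbr_run ctx (x v : G) z T :
  T = encg -> ctx = Cons T (encv x) ->
  runs p [:: encv v; ctx; z] closed_nbr_test (Num (closed_nbr x v)) (100 * b + 30).
Proof.
move=> -> ->; rewrite /closed_nbr.
apply: runs_le; first apply: (@runs_if _ _ _ _ _ _ _ _ (100 * b + 10)).
- by apply: runs_eqv; ev.
- by move=> ->; apply: runs_le; [ev | slia].
- by move=> /negbTE-> /=; apply: runs_le; [apply: runs_adj; ev | slia].
by slia.
Qed.

Lemma runs_closed_nbr env e (x : G) s T0 :
  size s <= #|G| + r + 4 -> runs p env e (Cons (Cons encg (encv x)) (encl s)) T0 ->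
  runs p env (Call f_closed_nbr e) (encl (filter (closed_nbr x) s)) (T0 + b ^ 4).
Proof.
apply: runs_vfilter => // v z; apply: runs_le; first exact: closed_nbr_run.
by have := b_pow2; move: hb; slia.
Qed.

Lemma runs_non_nbr env e (x : G) s T0 :
  size s <= #|G| + r + 4 -> runs p env e (Cons (Cons encg (encv x)) (encl s)) T0 ->
  runs p env (Call f_non_nbr e) (encl [seq y <- s | ~~ closed_nbr x y]) (T0 + b ^ 4).
Proof.
apply: runs_vfilter => // v z; apply: runs_le; first (apply: runs_not; exact: closed_nbr_run).
by have := b_pow2; move: hb; slia.
Qed.

Lemma runs_open_nbr env e (x : G) s T0 :
  size s <= #|G| + r + 4 -> runs p env e (Cons (Cons encg (encv x)) (encl s)) T0 ->
  runs p env (Call f_open_nbr e) (encl (filter (edge x) s)) (T0 + b ^ 4).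
Proof.
apply: runs_vfilter => // v z; apply: runs_le; first (apply: runs_adj; ev).
by have := b_pow2; move: hb; slia.
Qed.

Lemma runs_remove env e (x : G) s T0 :
  size s <= #|G| + r + 4 -> runs p env e (Cons (encv x) (encl s)) T0 ->
  runs p env (Call f_remove e) (encl [seq y <- s | y != x]) (T0 + b ^ 4).
Proof.
apply: runs_vfilter => // v z; apply: runs_le; first (apply: runs_not; apply: runs_eqv; ev).
by have := b_pow2; move: hb; slia.
Qed.

Lemma runs_co_nbr env e (x : G) s T0 :
  size s <= #|G| + r + 4 -> runs p env e (Cons (Cons encg (encv x)) (encl s)) T0 ->
  runs p env (Call f_co_nbr e) (encl (filter (co_nbr x) s)) (T0 + b ^ 4).
Proof.
apply: runs_vfilter => // v z; rewrite /co_nbr.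
apply: runs_le; first apply: (@runs_if _ _ _ _ _ _ _ _ (100 * b + 10)).
- by apply: runs_eqv; ev.
- by move=> ->; apply: runs_le; [ev | slia].
- by move=> /negbTE-> /=; apply: runs_le; [apply: runs_not; apply: runs_adj; ev | slia].
by have := b_pow2; move: hb; slia.
Qed.

Lemma runs_diff env e (C : seq G) s T0 :
  size C <= #|G| + r + 4 -> size s <= #|G| + r + 4 -> runs p env e (Cons (encl C) (encl s)) T0 ->
  runs p env (Call f_diff e) (encl [seq y <- s | y \notin C]) (T0 + b ^ 4).
Proof.
move=> hC; apply: runs_vfilter => // v z.
apply: runs_le; first (apply: runs_not; apply: runs_mem; ev).
by have := b_pow2; move: hb; slia.
Qed.

Lemma runs_near_gen self f_nbr (R : rel G) env e (C : seq G) s T0 :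
  onth p self = Some (filter_body self (near_test f_nbr)) ->
  (forall env e x s T0, size s <= #|G| + r + 4 -> runs p env e (Cons (Cons encg (encv x)) (encl s)) T0 ->
     runs p env (Call f_nbr e) (encl (filter (R x) s)) (T0 + b ^ 4)) ->
  size C <= #|G| + r + 4 -> size s <= #|G| + r + 4 -> runs p env e (Cons (Cons encg (encl C)) (encl s)) T0 ->
  runs p env (Call self e) (encl (filter (near R C) s)) (T0 + b ^ 7).
Proof.
move=> hself hR hC; apply: (runs_vfilter hself) => v z.
apply: runs_le; first (apply: runs_has; apply: hR => //; ev).
by have := b_pow 4; have := b_gt0 4; slia.
Qed.

Lemma runs_near env e (C : seq G) s T0 :
  size C <= #|G| + r + 4 -> size s <= #|G| + r + 4 -> runs p env e (Cons (Cons encg (encl C)) (encl s)) T0 ->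
  runs p env (Call f_near e) (encl (filter (near (@closed_nbr G) C) s)) (T0 + b ^ 7).
Proof. by apply: runs_near_gen => // *; apply: runs_closed_nbr. Qed.

Lemma runs_co_near env e (C : seq G) s T0 :
  size C <= #|G| + r + 4 -> size s <= #|G| + r + 4 -> runs p env e (Cons (Cons encg (encl C)) (encl s)) T0 ->
  runs p env (Call f_co_near e) (encl (filter (near (@co_nbr G) C) s)) (T0 + b ^ 7).
Proof. by apply: runs_near_gen => // *; apply: runs_co_nbr. Qed.

Lemma runs_closure self f_nr (R : rel G) env e (U C : seq G) (fuel : seq G) T0 :
  onth p self = Some (closure_body self f_nr) ->
  (forall env e C s T0, size C <= #|G| + r + 4 -> size s <= #|G| + r + 4 ->
     runs p env e (Cons (Cons encg (encl C)) (encl s)) T0 ->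
     runs p env (Call f_nr e) (encl (filter (near R C) s)) (T0 + b ^ 7)) ->
  size C <= #|G| + r + 4 -> size U <= #|G| + r + 4 ->
  runs p env e (Cons encg (Cons (encl U) (Cons (encl C) (encl fuel)))) T0 ->
  runs p env (Call self e) (encl (saturate R U C (size fuel)))
    (T0 + (b ^ 7 + 60) * (size fuel).+1).
Proof.
move=> hself hR + hU; elim: fuel C env e T0 => [|x fuel IHf] C env e T0 hC he.
  apply: runs_le; first (apply: runs_call hself he _; apply: (@runs_if _ _ _ _ _ false) => //).
  - by ev.
  - by move=> _; ev.
  by slia.
apply: runs_le; first (apply: runs_call hself he _; apply: (@runs_if _ _ _ _ _ true) => //).
- by ev.
- move=> _; rewrite /saturate iterSr; apply: IHf.
    by rewrite (leq_trans _ hU) // size_filter count_size.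
  eapply runs_op2; [by ev | | reflexivity].
  eapply runs_op2; [by ev | | reflexivity].
  eapply runs_op2; [ | by ev | reflexivity].
  by apply: hR => //; ev.
by move=> /=; slia.
Qed.

Lemma closure_cost n : n <= #|G| + r + 4 -> (b ^ 7 + 60) * n.+1 <= b ^ 9.
Proof.
move=> hn; apply: (@leq_trans (b ^ 8 * b)); last by rewrite -expnSr.
apply: leq_mul; last by move: hb; slia.
by have := b_pow 7; have := b_gt0 7; slia.
Qed.

Lemma runs_component env e (U C fuel : seq G) T0 :
  size C <= #|G| + r + 4 -> size U <= #|G| + r + 4 -> size fuel <= #|G| + r + 4 ->
  runs p env e (Cons encg (Cons (encl U) (Cons (encl C) (encl fuel)))) T0 ->
  runs p env (Call f_component e) (encl (saturate (@closed_nbr G) U C (size fuel))) (T0 + b ^ 9).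
Proof.
move=> hC hU hf he; apply: runs_le.
  by apply: (runs_closure _ _ hC hU he) => //; exact: runs_near.
by rewrite leq_add2l closure_cost.
Qed.

Lemma runs_co_component env e (U C fuel : seq G) T0 :
  size C <= #|G| + r + 4 -> size U <= #|G| + r + 4 -> size fuel <= #|G| + r + 4 ->
  runs p env e (Cons encg (Cons (encl U) (Cons (encl C) (encl fuel)))) T0 ->
  runs p env (Call f_co_component e) (encl (saturate (@co_nbr G) U C (size fuel))) (T0 + b ^ 9).
Proof.
move=> hC hU hf he; apply: runs_le.
  by apply: (runs_closure _ _ hC hU he) => //; exact: runs_co_near.
by rewrite leq_add2l closure_cost.
Qed.

Lemma runs_len env e (s : seq G) T0 :
  size s <= #|G| + r + 4 -> runs p env e (encl s) T0 ->
  runs p env (Call f_length e) (Num (size s)) (T0 + b ^ 2).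
Proof.
move=> hs he; apply: runs_le; first exact: runs_length he.
by rewrite leq_add2l; have := b_pow2; move: hb; slia.
Qed.

Lemma runs_app env e (s1 s2 : seq G) T0 :
  size s1 <= #|G| + r + 4 -> runs p env e (Cons (encl s1) (encl s2)) T0 ->
  runs p env (Call f_append e) (encl (s1 ++ s2)) (T0 + b ^ 2).
Proof.
move=> hs he; apply: runs_le; first exact: runs_append he.
by rewrite leq_add2l; have := b_pow2; move: hb; slia.
Qed.

Lemma runs_tup env e (s : seq G) n T0 :
  size s <= #|G| + r + 4 -> n <= b.-1 -> runs p env e (Cons (encl s) (Num n)) T0 ->
  runs p env (Call f_tuples e) (encll (tuples s n)) (T0 + b ^ n.+3).
Proof.
move=> hs hn he; apply: runs_le.
  by apply: (@runs_tuples p _ _ _ f_pairs f_map_cons _ _ _ _ b) he => //; move: hb; slia.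
rewrite leq_add2l (expnS b n.+2) (expnS b n.+1) mulnA; apply: leq_mul => //.
by apply: leq_mul; move: hb hn; slia.
Qed.

Lemma tuples_size (s : seq G) n : size s <= #|G| + r + 4 -> size (tuples s n) <= b ^ n.
Proof. by move=> hs; rewrite size_tuples; apply: leq_expl; move: hb; slia. Qed.

Lemma runs_p4 env e (U : seq G) T0 :
  size U <= #|G| + r + 4 -> runs p env e (Cons encg (encll (tuples U 4))) T0 ->
  runs p env (Call f_p4 e) (encll (p4s U)) (T0 + b ^ 10).
Proof.
move=> hU he; apply: runs_le.
  apply: (@runs_filter p _ encl (@is_p4 G) _ _ _ (b ^ 2)) he => // P.
  case/tuplesP; case: P => [|x0 [|x1 [|x2 [|x3 []]]]] //= _ _ z.
  apply: runs_le.
  apply: runs_and => [|_]; first by apply: runs_adj; ev.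
  apply: runs_and => [|_]; first by apply: runs_adj; ev.
  apply: runs_and => [|_]; first by apply: runs_adj; ev.
  apply: runs_and => [|_]; first by apply: runs_not; apply: runs_adj; ev.
  apply: runs_and => [|_]; first by apply: runs_not; apply: runs_adj; ev.
  by apply: runs_not; apply: runs_adj; ev.
  by have := b_pow2; move: hb; slia.
rewrite leq_add2l; apply: (@leq_trans (b ^ (2 + 5).+1)); last by apply: leq_pexp2l => //; slia.
apply: leq_filter_cost => //; have := tuples_size 4 hU; have := b_pow 4; have := b_gt0 4; slia.
Qed.

Lemma runs_p4s env g e (U : seq G) T0 T1 :
  size U <= #|G| + r + 4 -> runs p env g encg T0 -> runs p env e (encl U) T1 ->
  runs p env (p4s_ g e) (encll (p4s U)) (T0 + T1 + b ^ 11).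
Proof.
move=> hU h0 h1; apply: runs_le.
  apply: runs_p4 => //; eapply runs_op2; [exact: h0 | | reflexivity].
  apply: runs_tup => //; [by move: hb; lia | by ev].
have := b_pow 10; have := b_gt0 10; have := leq_pexp2l (n2 := 10) (_ : 0 < b) (_ : 7 <= 10).
by move: hb; slia.
Qed.

(** [b ^ 4] bounds the number of 4-tuples of vertices; the length 4 of the entries bounds the cost
    of a test on one of them. *)
Definition valid_p4s (Ps : seq (seq G)) :=
  size Ps <= b ^ 4 /\ {in Ps, forall P, size P = 4}.

Lemma valid_filter a Ps : valid_p4s Ps -> valid_p4s (filter a Ps).
Proof.
move=> [h1 h2]; split; last by move=> P; rewrite mem_filter => /andP[_ /h2].
by rewrite size_filter (leq_trans (count_size _ _)).
Qed.

Lemma valid_p4s_tuples (U : seq G) : size U <= #|G| + r + 4 -> valid_p4s (p4s U).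
Proof.
move=> hU; apply: valid_filter; split; first exact: tuples_size.
by move=> P /tuplesP[].
Qed.

Lemma runs_pfilter self test ctx (a : pred (seq G)) env e Ps T0 i :
  onth p self = Some (filter_body self test) ->
  (forall P z, size P = 4 -> runs p [:: encl P; ctx; z] test (Num (a P)) (b ^ i)) ->
  valid_p4s Ps ->
  runs p env e (Cons ctx (encll Ps)) T0 ->
  runs p env (Call self e) (encll (filter a Ps)) (T0 + b ^ (i + 6)).
Proof.
move=> h1 h2 [s1 s2] h3; apply: runs_le; first (apply: runs_filter h1 _ h3 => P /s2 P4 z; exact: h2).
rewrite leq_add2l (addnS i); apply: leq_filter_cost => //.
by have := b_pow 4; have := b_gt0 4; slia.
Qed.

Lemma mem_cost (P : seq G) : size P = 4 -> 1 + 1 + 40 * (size P).+1 + 2 + 100 <= b ^ 2.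
Proof. by move=> ->; have := b_pow2; move: hb; slia. Qed.

Lemma runs_contain env e (x : G) Ps T0 :
  valid_p4s Ps -> runs p env e (Cons (encv x) (encll Ps)) T0 ->
  runs p env (Call f_contain e) (encll [seq P : seq G <- Ps | x \in P]) (T0 + b ^ 8).
Proof.
apply: (@runs_pfilter f_contain _ _ _ _ _ _ _ 2) => // P z sP.
by apply: runs_le; [apply: runs_mem; ev | have := mem_cost sP; lia].
Qed.

Lemma runs_avoid env e (x : G) Ps T0 :
  valid_p4s Ps -> runs p env e (Cons (encv x) (encll Ps)) T0 ->
  runs p env (Call f_avoid e) (encll [seq P : seq G <- Ps | x \notin P]) (T0 + b ^ 8).
Proof.
apply: (@runs_pfilter f_avoid _ _ _ _ _ _ _ 2) => // P z sP.
by apply: runs_le; [apply: runs_not; apply: runs_mem; ev | have := mem_cost sP; lia].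
Qed.

Lemma touched_run (X : seq G) P z T :
  size X <= #|G| + r + 4 -> size P <= #|G| + r + 4 -> T = encg ->
  runs p [:: encl P; Cons T (encl X); z] touched_test (Num (touched X P)) (b ^ 7 + 10).
Proof.
move=> hX hP ->; apply: runs_le; first (apply: runs_has; apply: runs_near => //; ev).
by slia.
Qed.

Lemma touched_test_cost : b ^ 7 + 20 <= b ^ 8.
Proof. by have := b_pow 7; have := b_gt0 7; slia. Qed.

Lemma runs_touched env e (X : seq G) Ps T0 :
  size X <= #|G| + r + 4 -> valid_p4s Ps ->
  runs p env e (Cons (Cons encg (encl X)) (encll Ps)) T0 ->
  runs p env (Call f_touched e) (encll (filter (touched X) Ps)) (T0 + b ^ 14).
Proof.
move=> hX; apply: (@runs_pfilter f_touched _ _ _ _ _ _ _ 8) => // P z sP.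
apply: runs_le; first by apply: touched_run => //; rewrite sP; slia.
by have := touched_test_cost; slia.
Qed.

Lemma runs_untouched env e (X : seq G) Ps T0 :
  size X <= #|G| + r + 4 -> valid_p4s Ps ->
  runs p env e (Cons (Cons encg (encl X)) (encll Ps)) T0 ->
  runs p env (Call f_untouched e) (encll [seq P <- Ps | ~~ touched X P]) (T0 + b ^ 14).
Proof.
move=> hX; apply: (@runs_pfilter f_untouched _ _ _ _ _ _ _ 8) => // P z sP.
apply: runs_le; first by apply: runs_not; apply: touched_run => //; rewrite sP; slia.
by have := touched_test_cost; slia.
Qed.

Lemma runs_mul m e env n T :
  runs p env e (Num n) T -> runs p env (mul_ m e) (Num (m * n)) (m * T.+1).+1.
Proof.
move=> he; elim: m => [|m IHm] /=; first exact: runs_const.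
apply: runs_le; first by eapply runs_op2; [exact: he | exact: IHm | reflexivity].
by rewrite mulSn; lia.
Qed.

Lemma runs_plen env e Ps T0 :
  valid_p4s Ps -> runs p env e (encll Ps) T0 ->
  runs p env (Call f_length e) (Num (size Ps)) (T0 + b ^ 5).
Proof.
move=> [hs _] he; apply: runs_le; first exact: runs_length he.
by rewrite leq_add2l; have := b_pow 4; have := b_gt0 4; slia.
Qed.

Lemma runs_heavy env e Ps U T0 :
  size U <= #|G| + r + 4 -> valid_p4s Ps ->
  runs p env e (Cons (Cons encg (encll Ps)) (encl U)) T0 ->
  runs p env (Call f_heavy e) (encl (filter (heavy c Ps) U)) (T0 + b ^ 17).
Proof.
move=> hU hPs; apply: runs_vfilter => // v z.
apply: runs_le.
  eapply runs_let.
    apply: (@runs_plen _ _ (filter (touched [:: v]) Ps)); first exact: valid_filter.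
    by apply: (@runs_touched _ _ [:: v]) => //=; [lia | ev].
  eapply runs_op2; [apply: (runs_plen hPs); ev | apply: runs_mul; ev | reflexivity].
have h5 : 1000 * b ^ 5 <= b ^ 14.
  by apply: leq_trans (b_pow 5) _; apply: leq_pexp2l => //; move: hb; lia.
have : 1 <= b ^ 14 by exact: b_gt0.
have : b <= b ^ 14.
  by rewrite -[X in X <= _]expn1; apply: leq_pexp2l => //; move: hb; lia.
by have := b_pow 14; move: hb h5; lia.
Qed.

Lemma runs_p4_free env e Ps U T0 :
  size U <= #|G| + r + 4 -> valid_p4s Ps ->
  runs p env e (Cons (encll Ps) (encl U)) T0 ->
  runs p env (Call f_p4_free e) (encl (filter (p4_free Ps) U)) (T0 + b ^ 11).
Proof.
move=> hU hPs; apply: runs_vfilter => // v z; rewrite /p4_free.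
apply: runs_le; first by apply: runs_not; apply: runs_has; apply: (runs_contain hPs); ev.
by have := b_pow 8; have := b_gt0 8; lia.
Qed.

Lemma runs_weight env e (s : seq G) T0 :
  size s <= #|G| + r + 4 -> runs p env e (Cons encg (encl s)) T0 ->
  runs p env (Call f_weight e) (Wgt (\sum_(x <- s) w x)%R) (T0 + b ^ 4).
Proof.
move=> hs he; apply: (@runs_le _ _ _ _ (T0 + (30 * b + 60) * (size s).+1)); last first.
  rewrite leq_add2l; apply: (@leq_trans (b ^ 2 * b)); last by rewrite -expnSr leq_pexp2l //; move: hb; lia.
  by apply: leq_mul; have := b_pow2; move: hb hs; slia.
elim: s env e T0 {hs} he => [|x s IHs] env e T0 he.
  rewrite big_nil.
  apply: runs_le; first (apply: (runs_call (body := weight_body)) he _ => //; apply: (@runs_if _ _ _ _ _ false) => //).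
  - by ev.
  - by move=> _; ev.
  by lia.
rewrite big_cons.
apply: runs_le; first (apply: (runs_call (body := weight_body)) he _ => //; apply: (@runs_if _ _ _ _ _ true) => //).
- by ev.
- have hi : enum_rank x < size (enum G) by rewrite -cardE ltn_ord.
  move=> _; have hw : runs p [:: Cons encg (encl (x :: s))]
      (fst_ (Call f_nth (cons_ (fst_ (Var 0)) (fst_ (snd_ (Var 0)))))) (Wgt (w x)) (30 * b + 9).
    apply: runs_le; first eapply runs_op1.
    - by apply: (@runs_nth p _ _ f_nth _ _ _ x _ _ erefl hi); ev.
    - by rewrite nth_enum_rank.
    have : enum_rank x < #|G| by [].
    by move: hb; lia.
  by eapply runs_op2; [exact: hw | apply: IHs; ev | reflexivity].
by move=> /=; move: hb; slia.
Qed.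

(** Only the length of the list matters: the program applies this function to the encoded graph,
    which has one entry per vertex. *)
Lemma runs_iota (A : Type) (f : A -> value) env e (s : seq A) i T0 :
  runs p env e (Cons (encode_seq f s) (Num i)) T0 ->
  runs p env (Call f_iota e) (encode_seq Num (iota i (size s))) (T0 + 60 * (size s).+1).
Proof.
elim: s i env e T0 => [|x s IHs] i env e T0 he.
  apply: runs_le; first (apply: (runs_call (body := iota_body)) he _ => //; apply: (@runs_if _ _ _ _ _ false) => //).
  - by ev.
  - by move=> _; ev.
  by lia.
apply: runs_le; first (apply: (runs_call (body := iota_body)) he _ => //; apply: (@runs_if _ _ _ _ _ true) => //).
- by ev.
- move=> _ /=; eapply runs_op2; [by ev | | reflexivity].
  by rewrite -(addn1 i); apply: IHs; ev.
by move=> /=; slia.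
Qed.

Lemma encode_enum : encl (enum G) = encode_seq Num (iota 0 #|G|).
Proof.
have -> : iota 0 #|G| = [seq nat_of_ord (enum_rank x) | x <- enum G].
  apply: (@eq_from_nth _ 0) => [|i]; first by rewrite size_iota size_map -cardE.
  rewrite size_iota => hi; rewrite nth_iota // add0n.
  have x0 : G by case: (enum G) (cardE G) hi => [->|x _ _ _].
  rewrite (nth_map x0) -?cardE //.
  by have := enum_valK (Ordinal hi); rewrite (enum_val_nth x0) /= => ->.
by elim: (enum G) => //= x s ->.
Qed.

Lemma runs_main (v : value) T :
  runs p [:: Cons encg (encl (enum G))] solve_body v T ->
  exists2 t, run p encg v t & t <= T + 100 * b.
Proof.
move=> h.
have : runs p [:: encg] (Call 0 (Var 0)) v (T + 100 * b); last by [].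
apply: runs_le.
  apply: (runs_call (body := main_body)) => //; first by ev.
  apply: (runs_call (body := solve_body)) h => //.
  eapply runs_op2; [by ev | | reflexivity].
  by rewrite encode_enum cardE; apply: runs_iota; ev.
have hN : size (enum G) + 1000 <= b.
  by rewrite -cardE; apply: leq_trans hb; rewrite leq_add2r -addnA leq_addr.
by move: (size (enum G)) hN => n; lia.
Qed.

End Helpers.

(** * Balanced bags *)

Section Trees.
Variable T : sgraph.
Hypothesis treeT : is_tree T.

(** A duplicate-free path from [t] to [t'] without this edge would close up with it to a cycle. *)
Lemma tree_cut_edge (t t' : T) : edge t t' ->
  ~~ connect [rel u v | edge u v && ((u, v) != (t, t')) && ((u, v) != (t', t))] t t'.
Proof.
move=> tt'; apply/negP => /connectP[q /shortenP[q' pq' uq' _] tl].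
case: treeT => _ _ /(_ (t :: q')) cyc.
have pe : path edge t q'.
  by apply: sub_path pq' => u v /= /andP[/andP[]].
have /cyc : ucycle edge (t :: q').
  by rewrite /ucycle uq' andbT /= rcons_path pe -tl edge_sym.
(* [is_tree] excludes only cycles of size at least 3, so the short paths remain: the empty one gives
   a loop, and the one of length 1 is the deleted edge. *)
case: q' pq' uq' tl {cyc pe} => [|x [|y q']] //=.
  by move=> _ _ e; move: tt'; rewrite e edge_irr.
by move=> + _ e; rewrite -e eqxx andbF.
Qed.

(** Iterating [f] in a finite tree ends in a periodic orbit, which is a cycle of the tree and thus
    has size at most 2. Size 1 would be a loop. *)
Lemma tree_two_cycle (f : T -> T) : (forall t, edge t (f t)) -> exists t, f (f t) = t.
Proof.
move=> ef; case: treeT => /card_gt0P[t0 _] _ cyc.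
have /loopingP/(_ (order f t0)) := looping_order f t0.
case/trajectP=> i ilt /esym e; set t := iter i f t0.
have [m em] : exists m, iter m.+1 f t = t.
  exists (order f t0 - i).-1; rewrite prednK ?subn_gt0 // /t -iterD subnK //; exact: ltnW.
have fc : fcycle f (orbit f t).
  by apply/(orbitPcycle 3 0); exists m.
have uc : ucycle edge (orbit f t).
  rewrite /ucycle orbit_uniq andbT; apply: sub_cycle fc => u v /= /eqP <-; exact: ef.
have := cyc _ uc; rewrite size_orbit.
have := iter_order_cycle fc (in_orbit f t) (in_orbit f t).
case: (order f t) (order_gt0 f t) => [|[|[|]]] //= _.
- by move=> ft; have := ef t; rewrite ft edge_irr.
- by move=> ? _; exists t.
Qed.
End Trees.

Definition connected_set (G : sgraph) (C : {set G}) : Prop :=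
  {in C &, forall x y, connect [rel u v | [&& u \in C, v \in C & edge u v]] x y}.

Section Balanced.
Variables (G : sgraph) (D : tree_decomposition G).

Definition avoiding (t : td_tree D) : rel (td_tree D) :=
  [rel u v | [&& u != t, v != t & edge u v]].

Lemma avoiding_sym t : connect_sym (avoiding t).
Proof. by apply: sym_connect_sym => u v; rewrite /avoiding /= edge_sym andbCA. Qed.

(** The nodes whose bags contain [x] are connected in the tree and do not include [t]. *)
Lemma bags_same_side (t s s' : td_tree D) (x : G) :
  x \notin td_bag t -> x \in td_bag s -> x \in td_bag s' -> connect (avoiding t) s s'.
Proof.
move=> xt xs xs'; apply: connect_sub (td_connected xs xs') => u v /= /and3P[xu xv uv].
apply: connect1; rewrite /avoiding /= uv andbT.
by apply/andP; split; apply: contraNneq xt => <-.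
Qed.

Lemma connected_same_side (t s s' : td_tree D) (C : {set G}) x y :
  connected_set C -> [disjoint C & td_bag t] -> x \in C -> y \in C ->
  x \in td_bag s -> y \in td_bag s' -> connect (avoiding t) s s'.
Proof.
move=> conC dis xC yC; have /connectP[q pq ->] := conC _ _ xC yC.
have notin z : z \in C -> z \notin td_bag t by move=> zC; rewrite (disjointFr dis zC).
elim: q x s xC pq => [|z q IHq] x s xC /=; first by move=> _ xs xs'; apply: bags_same_side xs xs'; exact: notin.
case/andP=> /and3P[_ zC xz] pq xs hs'.
have [s1 /andP[xs1 zs1]] := td_edge D xz.
apply: connect_trans (IHq z s1 zC pq zs1 hs').
by apply: bags_same_side xs xs1; exact: notin.
Qed.

(** If every node [t] failed, some connected set with more than half of [U] would miss its bag and
    live on one side of [t]. Orient [t] towards that side. By [tree_two_cycle] two adjacent nodes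
    point at each other, yet their two large sets share a vertex, whose bags cannot lie on both far
    sides. *)
Lemma balanced_bag (U : {set G}) : exists t : td_tree D,
  forall C : {set G}, C \subset U -> [disjoint C & td_bag t] -> connected_set C ->
    #|C| + #|C| <= #|U|.
Proof.
apply: contrapT => /forallNP hn.
have hC (t : td_tree D) : exists C : {set G}, [/\ C \subset U, [disjoint C & td_bag t],
    connected_set C & #|U| < #|C| + #|C|].
  apply: contrapT => /forallNP hC; apply: (hn t) => C CU dis con.
  by rewrite leqNgt; apply/negP => lt; apply: (hC C).
have hf (t : td_tree D) : exists t' : td_tree D, edge t t' /\
    exists C : {set G}, [/\ C \subset U, #|U| < #|C| + #|C| &
      forall x s, x \in C -> x \in td_bag s -> connect (avoiding t) t' s].
  have [C [CU dis con big]] := hC t.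
  have /card_gt0P[x xC] : 0 < #|C| by move: big; lia.
  have [s xs] := td_vertex D x.
  have st : s != t.
    by apply/eqP => e; move: (disjointFr dis xC); rewrite -e xs.
  have [_ conT _] := td_is_tree D.
  (* The chosen neighbour [t'] is the second node of a duplicate-free path from [t] to [s]; the
     remainder of that path avoids [t]. *)
  have /connectP[q /shortenP[q' pq' uq' _] es] := conT t s.
  case: q' pq' uq' es => [|t' q'] /=; first by move=> _ _ e; rewrite e eqxx in st.
  case/andP=> tt' pq' /andP[tq' _] es; exists t'; split => //; exists C; split => // y s' yC ys'.
  apply: connect_trans (connected_same_side con dis xC yC xs ys').
  apply/connectP; exists q' => //.
  elim: q' t' {tt' es} tq' pq' => //= v q' IHq u.
  rewrite !inE !negb_or => /and3P[tu tv tq'] /andP[uv pq'].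
  apply/andP; split; last by apply: IHq => //; rewrite inE negb_or tv.
  by rewrite /avoiding /= [v == t]eq_sym [u == t]eq_sym tu tv uv.
have [f hf'] := choice hf.
have [t ft] := tree_two_cycle (td_is_tree D) (fun t => (hf' t).1).
have [tt' [C [CU bigC sideC]]] := hf' t.
have [_ [C' [CU' bigC' sideC']]] := hf' (f t); rewrite ft in sideC'.
have /set0Pn[x] : C :&: C' != set0.
  apply/eqP => e0; have := cardsUI C C'; rewrite e0 cards0 addn0.
  have : #|C :|: C'| <= #|U| by apply: subset_leq_card; rewrite subUset CU.
  by move: bigC bigC'; lia.
(* The node [s] is reached from [t] avoiding [f t], and from [f t] avoiding [t]. The two paths
   together join the ends of the edge between [t] and [f t] without using it. *)
rewrite inE => /andP[xC xC']; have [s xs] := td_vertex D x.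
move/negP: (tree_cut_edge (td_is_tree D) tt'); apply.
apply: (@connect_trans _ _ s).
  apply: connect_sub (sideC' _ _ xC' xs) => u v /= /and3P[uf vf uv].
  apply: connect1; rewrite /= uv /= !xpair_eqE !negb_and vf uf !orbT.
  by [].
have := sideC _ _ xC xs; rewrite avoiding_sym.
apply: connect_sub => u v /= /and3P[uf vf uv].
by apply: connect1; rewrite /= uv /= !xpair_eqE !negb_and vf uf !orbT.
Qed.
End Balanced.

(** * Packings of induced four-vertex paths *)

Section Packings.
Variable G : sgraph.
Implicit Types (B : {set G}) (P X : seq G) (Q : seq (seq G)).

Lemma graph_iso_sym (G1 G2 : sgraph) : graph_iso G1 G2 -> graph_iso G2 G1.
Proof.
case=> f [[g fK gK] fe]; exists g; split; first by exists f.
by move=> x y; rewrite -fe !gK.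
Qed.

Lemma graph_iso_trans (G1 G2 G3 : sgraph) :
  graph_iso G1 G2 -> graph_iso G2 G3 -> graph_iso G1 G3.
Proof.
case=> f [bf fe] [g [bg ge]]; exists (g \o f); split; first exact: bij_comp.
by move=> x y; rewrite /= ge fe.
Qed.

Lemma closed_nbr_sym : symmetric (@closed_nbr G).
Proof. by move=> x y; rewrite /closed_nbr eq_sym edge_sym. Qed.

Lemma touchedP X P :
  reflect (exists x y, [/\ x \in X, y \in P & closed_nbr x y]) (touched X P).
Proof.
apply: (iffP hasP) => [[y yP /hasP[x xX xy]]|[x [y [xX yP xy]]]].
  by exists x, y; rewrite closed_nbr_sym.
by exists y => //; apply/hasP; exists x => //; rewrite closed_nbr_sym.
Qed.

Lemma touched_sym X P : touched X P = touched P X.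
Proof.
by apply/touchedP/touchedP => -[x [y [xX yP xy]]]; exists y, x; split=> //; rewrite closed_nbr_sym.
Qed.

Lemma is_p4_edge P x (i j : nat) : is_p4 P -> i < 4 -> j < 4 ->
  edge (nth x P i) (nth x P j) = (i.+1 == j) || (j.+1 == i).
Proof.
case: P => [|x0 [|x1 [|x2 [|x3 []]]]] //= /and5P[e01 e12 e23 /negbTE n02 /andP[/negbTE n03 /negbTE n13]].
by case: i => [|[|[|[|]]]] // _; case: j => [|[|[|[|]]]] // _ /=;
  rewrite ?edge_irr // ?e01 ?e12 ?e23 ?n02 ?n03 ?n13 // edge_sym ?e01 ?e12 ?e23 ?n02 ?n03 ?n13.
Qed.

(** [is_p4] does not ask for distinct vertices. Distinctness follows because the four positions of a
    path have pairwise different neighbourhoods. *)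
Lemma is_p4_inj P x (i j : nat) : is_p4 P -> i < 4 -> j < 4 ->
  nth x P i = nth x P j -> i = j.
Proof.
move=> p4 hi hj e.
have h m : m < 4 -> (i.+1 == m) || (m.+1 == i) = (j.+1 == m) || (m.+1 == j).
  by move=> hm; rewrite -!(is_p4_edge x p4) // e.
have := h 0 isT; have := h 1 isT; have := h 2 isT; have := h 3 isT.
by move: i j hi hj {e h} => [|[|[|[|]]]] // [|[|[|[|]]]].
Qed.

Lemma is_p4_size P : is_p4 P -> size P = 4.
Proof. by case: P => [|x0 [|x1 [|x2 [|x3 []]]]]. Qed.

(** This is where the bound of 4 vertices on the path in the family enters. The subpath is chosen
    through a vertex of [B], since a rooted packing must stay rooted. *)
Lemma p4_sub_path B P s : 1 <= s <= 4 -> is_p4 P -> has (mem B) P ->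
  exists S : {set G}, [/\ {subset S <= P}, graph_iso (induced S) (path_graph s) & S :&: B != set0].
Proof.
move=> hs p4 /hasP[x xP xB]; have sP := is_p4_size p4.
have hi : index x P < 4 by rewrite -sP index_mem.
(* The [s] consecutive positions from [a] on stay below 4 and include the position of [x]. *)
pose a := minn (index x P) (4 - s).
have ha j : j < s -> a + j < 4 by rewrite /a; lia.
pose h (j : 'I_s) := nth x P (a + j).
have hinj : injective h.
  move=> i j /(is_p4_inj p4 (ha _ (ltn_ord i)) (ha _ (ltn_ord j))) /addnI e; exact: val_inj.
exists [set h j | j : 'I_s]; split.
- by move=> y /imsetP[j _ ->]; apply: mem_nth; rewrite sP ha.
- apply: graph_iso_sym.
  pose g (j : path_graph s) : induced [set h j | j : 'I_s] := exist _ (h j) (imset_f h isT).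
  have ginj : injective g by move=> i j /(congr1 val) /hinj.
  exists g; split; last first.
    by move=> i j; rewrite /= /induced_edge /= /h (is_p4_edge x p4) ?ha // -!addnS !eqn_add2l.
  apply: inj_card_bij => //=.
  by rewrite card_sig card_imset // card_ord.
- apply/set0Pn; exists x; rewrite inE; apply/andP; split; last exact: xB.
  have hj : index x P - a < s by rewrite /a; lia.
  apply/imsetP; exists (Ordinal hj) => //.
  by rewrite /h /= subnKC ?nth_index // /a geq_minl.
Qed.

Definition no_packing (k : nat) B := forall Q,
  {in Q, forall P, is_p4 P && has (mem B) P} ->
  pairwise (fun P P' => ~~ touched P P') Q -> size Q <= k.

Lemma no_packing_bag (H : sgraph -> Prop) k :
  (exists (s : nat) (P : sgraph), [/\ 1 <= s <= 4, H P & graph_iso P (path_graph s)]) ->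
  tree_pi H G <= k ->
  exists D : tree_decomposition G, forall t : td_tree D, no_packing k (td_bag t).
Proof.
move=> [s [F [hs HF isoF]]] hk.
have [D hD] : exists D : tree_decomposition G, packing_width H D <= k.
  move: hk; rewrite /tree_pi; case: ex_minnP => m /asboolP[D <-] _ hm; by exists D.
exists D => t Q hQ pw; apply: leq_trans hD.
set B := td_bag t.
(* The membership is placed inside the existential so that [choice] yields a total function; its
   value outside [Q] is irrelevant. *)
have hS (P : seq G) : exists S : {set G}, P \in Q ->
    [/\ {subset S <= P}, graph_iso (induced S) (path_graph s) & S :&: B != set0].
  have [PQ|] := boolP (P \in Q); last by exists set0.
  have /andP[p4 PB] := hQ _ PQ.
  by have [S hS] := p4_sub_path hs p4 PB; exists S.
have {hS}[S hS] := choice hS.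
have sepS i j : i < size Q -> j < size Q -> i != j ->
    ~~ touched (nth [::] Q i) (nth [::] Q j).
  move=> hi hj; rewrite neq_ltn => /orP[] ij; first by apply: (pairwiseP [::] pw).
  by rewrite touched_sym; apply: (pairwiseP [::] pw).
have untouched_S i j x y : i < size Q -> j < size Q -> i != j ->
    x \in S (nth [::] Q i) -> y \in S (nth [::] Q j) -> ~~ closed_nbr x y.
  move=> hi hj ij xS yS; apply: contra (sepS _ _ hi hj ij) => xy.
  have [sub _ _] := hS _ (mem_nth [::] hi); have [sub' _ _] := hS _ (mem_nth [::] hj).
  by apply/touchedP; exists x, y; rewrite (sub _ xS) (sub' _ yS).
(* [Q] is a list, so its entries are compared by position. Each chosen subpath is nonempty and
   untouched by the others, so different positions give different members of the packing. *)
have injS i j : i < size Q -> j < size Q ->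
    S (nth [::] Q i) = S (nth [::] Q j) -> i = j.
  move=> hi hj e; apply/eqP; apply/negP => /negP ij.
  have [_ _ /set0Pn[x]] := hS _ (mem_nth [::] hi); rewrite inE => /andP[xS _].
  have := untouched_S _ _ _ _ hi hj ij xS; rewrite -e => /(_ _ xS).
  by rewrite /closed_nbr eqxx.
have uS : uniq (map S Q).
  apply/(uniqP set0) => i j; rewrite !inE size_map => hi hj.
  by rewrite !(nth_map [::]) //; apply: injS.
pose Pk := [set X in map S Q].
have rk : rooted_packing H B Pk.
  split; last by move=> X; rewrite inE => /mapP[P PQ ->]; have [] := hS _ PQ.
  split=> [X|X X']; rewrite !inE.
    case/mapP=> P PQ ->; exists F; split => //; have [_ iso _] := hS _ PQ.
    exact: graph_iso_trans iso (graph_iso_sym isoF).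
  case/mapP=> P PQ -> /mapP[P' PQ' ->] XX'.
  have hi : index P Q < size Q by rewrite index_mem.
  have hj : index P' Q < size Q by rewrite index_mem.
  have ij : index P Q != index P' Q.
    apply: contraNneq XX' => e.
    by rewrite -(nth_index [::] PQ) e nth_index.
  have sep x y : x \in S P -> y \in S P' -> ~~ closed_nbr x y.
    move=> xS yS; apply: untouched_S hi hj ij _ _; by rewrite nth_index.
  split.
    apply/pred0P => x /=; apply/negP => /andP[xS xS'].
    by have := sep _ _ xS xS'; rewrite /closed_nbr eqxx.
  by move=> x y xS yS; have := sep _ _ xS yS; rewrite negb_or => /andP[].
have cPk : #|Pk| = size Q by rewrite cardsE (card_uniqP uS) size_map.
rewrite -cPk; apply: (@leq_trans (packing_number H B)).
  by rewrite /packing_number; apply: leq_bigmax_cond; apply/asboolP.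
by rewrite /packing_width; apply: (@leq_bigmax_cond _ xpredT _ t).
Qed.

Definition balances (s : nat) B (U : seq G) := forall C : {set G},
  (forall x, x \in C -> (x \in U) && (x \notin B)) -> connected_set C -> #|C| + #|C| <= s.

(** The quantifier over all [U] makes this one hypothesis on [G] that passes unchanged through the
    whole recursion. *)
Definition has_good_bags (k : nat) := forall U : seq G, uniq U ->
  exists B, no_packing k B /\ balances (size U) B U.

Lemma tree_pi_good_bags (H : sgraph -> Prop) k :
  (exists (s : nat) (P : sgraph), [/\ 1 <= s <= 4, H P & graph_iso P (path_graph s)]) ->
  tree_pi H G <= k -> has_good_bags k.
Proof.
move=> hH /(no_packing_bag hH) [D hD] U uU.
have [t ht] := balanced_bag D [set x in U]; exists (td_bag t); split => // C hC con.
rewrite -(card_uniqP uU) -[X in _ <= X]cardsE; apply: ht => //.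
  by apply/subsetP => x /hC /andP[xU _]; rewrite inE.
by apply/pred0P => x /=; apply/negP => /andP[/hC/andP[_ /negP]].
Qed.

(** Greedy choice. Every P4 touches itself, so the chosen ones are covered too. *)
Lemma maximal_packing B Q : {in Q, forall P, is_p4 P && has (mem B) P} ->
  exists Q', [/\ {subset Q' <= Q}, pairwise (fun P P' => ~~ touched P P') Q'
    & {in Q, forall P, touched (flatten Q') P}].
Proof.
elim: Q => [|P Q IHQ] hQ; first by exists [::].
have [P' P'Q|Q' [sub pw cov]] := IHQ; first by apply: hQ; rewrite inE P'Q orbT.
have [tP|tP] := boolP (touched (flatten Q') P).
  exists Q'; split => // [P' /sub P'Q|P']; first by rewrite inE P'Q orbT.
  by rewrite inE => /orP[/eqP->|/cov].
exists (P :: Q'); split => [P'|/=|P'].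
- by rewrite !inE => /orP[->|/sub ->]; rewrite ?orbT.
- rewrite pw andbT; apply/allP => P' P'Q; apply: contra tP.
  rewrite touched_sym => /touchedP[x [y [xP yP xy]]].
  by apply/touchedP; exists x, y; split => //; apply/flattenP; exists P'.
- have self : touched P P.
    have /andP[/is_p4_size] := hQ P (mem_head _ _); case: P {hQ tP} => // x P _ _.
    by apply/touchedP; exists x, x; rewrite mem_head /closed_nbr eqxx.
  rewrite inE => /orP[/eqP->|/cov /touchedP[x [y [xQ yP xy]]]].
    have /touchedP[x [y [xP yP xy]]] := self.
    by apply/touchedP; exists x, y; rewrite /= mem_cat xP.
  by apply/touchedP; exists x, y; rewrite /= mem_cat xQ orbT.
Qed.

Lemma guess_exists k B (U : seq G) Q : no_packing k B -> 
  {in Q, forall P, [&& is_p4 P, has (mem B) P & all (mem U) P]} -> U != [::] ->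
  exists2 X, X \in tuples U (4 * k) & {in Q, forall P, touched X P}.
Proof.
move=> npk hQ; case: U hQ => // u U hQ _.
have [P PQ|Q' [sub pw cov]] := @maximal_packing B Q.
  by have /and3P[-> ->] := hQ _ PQ.
have sQ' : size (flatten Q') <= 4 * k.
  have -> : size (flatten Q') = 4 * size Q'.
    elim: Q' sub {pw cov} => // P Q' IHQ sub; rewrite /= size_cat IHQ.
      have /and3P[/is_p4_size-> _ _] := hQ P (sub _ (mem_head _ _)); lia.
    by move=> P' P'Q; apply: sub; rewrite inE P'Q orbT.
  rewrite leq_mul2l; apply: npk => // P PQ.
  by have /and3P[-> ->] := hQ _ (sub _ PQ).
(* The program enumerates tuples of length exactly [4 * k], so a shorter packing is padded with a
   vertex of [U]; this is why [U] must be nonempty. *)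
exists (flatten Q' ++ nseq (4 * k - size (flatten Q')) u).
  apply/tuplesP; split; first by rewrite size_cat size_nseq subnKC.
  move=> x; rewrite mem_cat => /orP[/flattenP[P /sub PQ xP]|/nseqP[-> _]]; last exact: mem_head.
  by have /and3P[_ _ /allP/(_ _ xP)] := hQ _ PQ.
move=> P /cov /touchedP[x [y [xQ yP xy]]].
by apply/touchedP; exists x, y; rewrite mem_cat xQ.
Qed.

End Packings.

(** * Optimal independent sets *)

Section Closure.
Variables (G : sgraph) (R : rel G) (U : seq G).
Implicit Types (C : seq G) (n : nat).

Hypothesis Rxx : reflexive R.

Lemma saturateS C n : saturate R U C n.+1 = filter (near R (saturate R U C n)) U.
Proof. by []. Qed.

Lemma saturate_sub C n : {subset C <= U} -> {subset saturate R U C n <= U}.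
Proof. by case: n => // n _ x; rewrite saturateS mem_filter => /andP[]. Qed.

Lemma saturate_mono C n : {subset C <= U} -> {subset saturate R U C n <= saturate R U C n.+1}.
Proof.
move=> CU x xC; rewrite saturateS mem_filter (saturate_sub CU xC) andbT.
by apply/hasP; exists x.
Qed.

Lemma saturate_base C n : {subset C <= U} -> {subset C <= saturate R U C n}.
Proof. by move=> CU; elim: n => // n IHn x /IHn /saturate_mono; apply. Qed.

Lemma saturate_ind (Q : G -> Prop) C n :
  (forall x, x \in C -> Q x) -> (forall x y, x \in U -> Q x -> y \in U -> R y x -> Q y) ->
  {subset C <= U} -> forall x, x \in saturate R U C n -> Q x.
Proof.
move=> Q0 QS CU; elim: n => // n IHn x; rewrite saturateS mem_filter => /andP[/hasP[y yC xy] xU].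
by apply: (QS y) => //; [apply: saturate_sub yC | apply: IHn].
Qed.

(** The iteration starts nonempty and gains at least one element per round until it is stationary.
    It cannot exceed the size of [U], so it is stationary after [size U] rounds. *)
Lemma saturate_closed C : {subset C <= U} -> uniq U -> uniq C -> C != [::] ->
  forall x y, x \in saturate R U C (size U) -> y \in U -> R y x -> y \in saturate R U C (size U).
Proof.
move=> CU uU uC C0 x y xC yU yx.
have uCl n : uniq (saturate R U C n) by case: n => // n; rewrite saturateS filter_uniq.
have grow n : n < size (saturate R U C n) \/ saturate R U C n =i saturate R U C n.+1.
  elim: n => [|n [lt|eqn]]; first by left; case: (C) C0.
    have [le|eqS] := ltnP (size (saturate R U C n)) (size (saturate R U C n.+1)).
      by left; apply: leq_ltn_trans lt le.
    right; have e : saturate R U C n =i saturate R U C n.+1.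
      by have [] := uniq_min_size (uCl n) (@saturate_mono C n CU) eqS.
    by move=> z; rewrite !saturateS !mem_filter /near (eq_has_r e).
  by right=> z; rewrite !saturateS !mem_filter /near (eq_has_r eqn).
have [lt|->] := grow (size U).
  have := uniq_leq_size (uCl (size U)) (@saturate_sub C (size U) CU).
  by rewrite leqNgt lt.
by rewrite saturateS mem_filter yU andbT; apply/hasP; exists x.
Qed.

Lemma saturate_uniq C n : uniq U -> uniq C -> uniq (saturate R U C n).
Proof. by case: n => // n *; rewrite saturateS filter_uniq. Qed.

End Closure.

(** * Optima and their combination *)

Section Optimum.
Variables (G : sgraph) (w : G -> rat).
Hypothesis w0 : forall x, (0 <= w x)%R.
Implicit Types (U S : seq G) (J : {set G}).

Definition wsum S := (\sum_(x <- S) w x)%R.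

Definition indep_in U S :=
  [/\ uniq S, {subset S <= U} & {in S &, forall x y, ~~ edge x y}].

Definition sub_indep U J := (forall x, x \in J -> x \in U) /\ independent J.

(** The solution is a duplicate-free list, as produced by the program; the competitors are sets,
    which are easier to cut and glue in exchange arguments. *)
Definition optimal U S :=
  indep_in U S /\ forall J, sub_indep U J -> (weight w J <= wsum S)%R.

Lemma weight_split J (p : pred G) :
  weight w J = (weight w [set x in J | p x] + weight w [set x in J | ~~ p x])%R.
Proof.
rewrite /weight (bigID p) /=; congr (_ + _)%R; apply: eq_bigl => x; by rewrite inE.
Qed.

Lemma weight_seq S : uniq S -> weight w [set x in S] = wsum S.
Proof.
move=> uS; rewrite /weight /wsum big_uniq //=.
by apply: eq_bigl => x; rewrite inE.
Qed.

Lemma wsum_cat S1 S2 : wsum (S1 ++ S2) = (wsum S1 + wsum S2)%R.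
Proof. exact: big_cat. Qed.

Lemma wsum_cons x S : wsum (x :: S) = (w x + wsum S)%R.
Proof. exact: big_cons. Qed.

Lemma sub_indep_setI U U' J (p : pred G) : sub_indep U J ->
  (forall x, x \in J -> p x -> x \in U') -> sub_indep U' [set x in J | p x].
Proof.
move=> [JU indJ] h; split=> [x|x y]; rewrite !inE; first by case/andP=> /h.
by move=> /andP[xJ _] /andP[yJ _]; apply: indJ.
Qed.

Lemma weight_le1 J x : (forall y, y \in J -> y = x) -> (weight w J <= w x)%R.
Proof.
move=> h; have [xJ|xJ] := boolP (x \in J).
  rewrite /weight (bigD1 x) //= big1 ?addr0 // => y /andP[/h->].
  by rewrite eqxx.
rewrite /weight big1 // => y yJ; by move: xJ; rewrite -(h _ yJ) yJ.
Qed.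

Lemma optimal_small U : uniq U -> size U <= 1 -> optimal U U.
Proof.
move=> uU sU; split.
  split => // x y; case: U uU sU => [|z [|]] // _ _; rewrite !inE => /eqP-> /eqP->.
  by rewrite edge_irr.
move=> J [JU _]; rewrite -weight_seq // /weight.
rewrite [leRHS](bigID (mem J)) /= -[leLHS]addr0 lerD ?sumr_ge0 //.
by rewrite le_eqVlt; apply/orP; left; apply/eqP/eq_bigl => x; rewrite inE; case: (boolP (x \in J)) => [/JU ->|]; rewrite ?andbF.
Qed.

Lemma indep_in_cons U u S : u \in U -> indep_in [seq y <- U | ~~ closed_nbr u y] S ->
  indep_in U (u :: S).
Proof.
move=> uU [uS sub ind]; have nb y : y \in S -> ~~ closed_nbr u y.
  by move=> /sub; rewrite mem_filter => /andP[].
split=> /= [|y|x y].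
- by rewrite uS andbT; apply/negP => /nb; rewrite /closed_nbr eqxx.
- by rewrite inE => /orP[/eqP->|/sub] //; rewrite mem_filter => /andP[].
rewrite !inE => /orP[/eqP->|xS] /orP[/eqP->|yS]; first by rewrite edge_irr.
- by have := nb _ yS; rewrite negb_or => /andP[].
- by have := nb _ xS; rewrite negb_or edge_sym => /andP[].
- exact: ind.
Qed.

Lemma indep_in_sub U U' S : {subset U <= U'} -> indep_in U S -> indep_in U' S.
Proof. by move=> UU' [uS sub ind]; split => // x /sub /UU'. Qed.

Lemma indep_in_cat U S1 S2 U1 U2 : indep_in U1 S1 -> indep_in U2 S2 ->
  {subset U1 <= U} -> {subset U2 <= U} ->
  {in S1 & S2, forall x y, (x != y) && ~~ edge x y} -> indep_in U (S1 ++ S2).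
Proof.
move=> [u1 sub1 ind1] [u2 sub2 ind2] h1 h2 sep; split=> [|x|x y].
- rewrite cat_uniq u1 u2 andbT; apply/hasPn => y yS2; apply/negP => yS1.
  by have := sep _ _ yS1 yS2; rewrite eqxx.
- by rewrite mem_cat => /orP[/sub1/h1|/sub2/h2].
rewrite !mem_cat => /orP[x1|x2] /orP[y1|y2]; [exact: ind1 | | | exact: ind2].
  by case/andP: (sep _ _ x1 y2).
by rewrite edge_sym; case/andP: (sep _ _ y1 x2).
Qed.

Definition better S1 S2 := if (wsum S1 <= wsum S2)%R then S2 else S1.

Lemma better_cases (Q : seq G -> Prop) S1 S2 : Q S1 -> Q S2 -> Q (better S1 S2).
Proof. by rewrite /better; case: ifP. Qed.

Lemma better_ge S1 S2 : (wsum S1 <= wsum (better S1 S2))%R /\ (wsum S2 <= wsum (better S1 S2))%R.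
Proof. by rewrite /better; case: (lerP (wsum S1) (wsum S2)) => [le|/ltW le]; split. Qed.

Lemma optimal_branch U u S1 S2 : u \in U ->
  optimal [seq y <- U | ~~ closed_nbr u y] S1 -> optimal [seq y <- U | y != u] S2 ->
  optimal U (better (u :: S1) S2).
Proof.
move=> uU [ind1 opt1] [ind2 opt2]; split.
  apply: better_cases; first exact: indep_in_cons.
  by apply: indep_in_sub ind2 => x; rewrite mem_filter => /andP[].
have [ge1 ge2] := better_ge (u :: S1) S2.
move=> J indJ; have [JU iJ] := indJ; have [uJ|uJ] := boolP (u \in J).
  apply: le_trans ge1; rewrite wsum_cons (weight_split J (pred1 u)) lerD //.
    by apply: weight_le1 => y; rewrite inE => /andP[_ /eqP].
  apply: opt1; apply: sub_indep_setI indJ _ => x xJ /= xu.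
  by rewrite mem_filter JU // andbT negb_or eq_sym xu iJ.
apply: le_trans ge2; apply: opt2; split => // x xJ; rewrite mem_filter JU // andbT.
by apply: contraNneq uJ => <-.
Qed.

Lemma optimal_union U (C : seq G) S1 S2 : {subset C <= U} ->
  (forall x y, x \in C -> y \in U -> edge x y -> y \in C) ->
  optimal C S1 -> optimal [seq y <- U | y \notin C] S2 -> optimal U (S1 ++ S2).
Proof.
move=> CU cl [ind1 opt1] [ind2 opt2]; split.
  have [_ sub1 _] := ind1; have [_ sub2 _] := ind2.
  apply: indep_in_cat ind1 ind2 CU _ _ => [x|x y]; first by rewrite mem_filter => /andP[].
  move=> /sub1 xC /sub2; rewrite mem_filter => /andP[yC yU]; apply/andP; split.
    by apply: contraNneq yC => <-.
  by apply: contra yC; apply: cl.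
move=> J indJ; rewrite wsum_cat (weight_split J (mem C)) lerD //.
  by apply: opt1; apply: sub_indep_setI indJ _.
have [JU _] := indJ.
by apply: opt2; apply: sub_indep_setI indJ _ => x xJ xC; rewrite mem_filter xC JU.
Qed.

(** * Removing a vertex that lies in no induced four-vertex path *)

Section Join.
Variables (U : seq G) (b : G).
Hypotheses (bU : b \in U) (uU : uniq U) (freeb : p4_free (p4s U) b).
Let D := [seq y <- U | ~~ closed_nbr b y].

Lemma no_p4_through P : {subset P <= U} -> b \in P -> ~~ is_p4 P.
Proof.
move=> PU bP; apply: contra freeb => p4; apply/hasP; exists P => //.
by rewrite mem_filter p4 andTb; apply/tuplesP; split => //; apply: is_p4_size.
Qed.

(** Otherwise [b], [a], [d], [d'] would form a P4. Along paths in [D] this makes [a] complete or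
    anticomplete to each component of [D]. *)
Lemma nbr_separates_components a d d' : a \in U -> edge b a -> d \in D -> d' \in D ->
  edge a d -> edge d d' -> edge a d'.
Proof.
rewrite !mem_filter !negb_or => aU ba /andP[/andP[_ bd] dU] /andP[/andP[_ bd'] d'U] ad dd'.
apply: contraTT isT => ad'.
have := @no_p4_through [:: b; a; d; d']; rewrite mem_head /= ba ad dd' bd bd' ad' /=.
by apply => // x; rewrite !inE => /or4P[] /eqP->.
Qed.

(** Otherwise [a'], [b], [a], [d] would form a P4. *)
Lemma nonadjacent_nbrs_twins a a' d : a \in U -> a' \in U -> edge b a -> edge b a' ->
  ~~ edge a a' -> d \in D -> edge a d -> edge a' d.
Proof.
rewrite mem_filter negb_or => aU a'U ba ba' aa' /andP[/andP[_ bd] dU] ad.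
apply: contraTT isT => a'd.
have := @no_p4_through [:: a'; b; a; d]; rewrite !inE eqxx orbT /= [edge a' b]edge_sym ba' ba ad.
rewrite [edge a' a]edge_sym aa' a'd bd /=.
by apply => // x; rewrite !inE => /or4P[] /eqP->.
Qed.

(* [best] is optimal among the independent sets that avoid the neighbours [A]
   of [b] which remain to be treated. *)
Definition join_inv (A S best : seq G) :=
  [/\ indep_in U best, optimal D S & uniq A] /\
  [/\ (forall J, sub_indep U J -> (forall x, x \in J -> x \notin A) ->
        (weight w J <= wsum best)%R),
      (forall x, x \in A -> (x \in U) && edge b x)
    & (forall x y, x \in U -> edge b x -> x \notin A -> y \in A -> edge x y)].

Lemma join_start S : optimal D S -> join_inv (filter (edge b) U) S (b :: S).
Proof.
move=> optS; have [indS opt] := optS; split; first split => //.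
- exact: indep_in_cons.
- exact: filter_uniq.
split=> [J indJ nJ|x|x y xU bx]; last 1 first.
- by rewrite mem_filter xU bx.
- have [JU _] := indJ; rewrite wsum_cons (weight_split J (pred1 b)) lerD //.
    by apply: weight_le1 => y; rewrite inE => /andP[_ /eqP].
  apply: opt; apply: sub_indep_setI indJ _ => x xJ /= xb.
  rewrite mem_filter JU // andbT negb_or eq_sym xb /=.
  by have := nJ _ xJ; rewrite mem_filter JU // andbT.
by rewrite mem_filter andbC.
Qed.

Lemma join_end S best : join_inv [::] S best -> optimal U best.
Proof. by case=> [[indb _ _] [opt _ _]]; split => // J indJ; apply: opt. Qed.

Section Step.
Variables (a : G) (A S best SK : seq G).
Let K := saturate (@co_nbr G) (a :: A) [:: a] (size (a :: A)).
Hypotheses (inv : join_inv (a :: A) S best) (optK : optimal K SK).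
Let cand := SK ++ [seq y <- S | ~~ closed_nbr a y].

Lemma co_nbr_refl : reflexive (@co_nbr G).
Proof. by move=> x; rewrite /co_nbr eqxx. Qed.

Let aA : {subset [:: a] <= a :: A}.
Proof. by move=> x; rewrite !inE => ->. Qed.

Let KA x : x \in K -> [&& x \in a :: A, x \in U & edge b x].
Proof.
move=> xK; have xA : x \in a :: A by apply: saturate_sub xK.
by case: inv => _ [_ /(_ _ xA) h _]; rewrite xA h.
Qed.

(** The twin property propagates along the non-edges by which [K] is built up from [a]. The single
    vertex [a] thus represents all of [K] in tests against [D], both here and in the program. *)
Lemma co_component_nbrs d x : d \in D -> x \in K -> edge x d = edge a d.
Proof.
case: inv => _ [_ hA _] dD.
apply: (saturate_ind (Q := fun x => edge x d = edge a d)) => // [y|y z yA ed zA].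
  by rewrite inE => /eqP->.
rewrite /co_nbr => /orP[/eqP-> //|zy].
have /andP[yU by_] := hA _ yA; have /andP[zU bz] := hA _ zA.
rewrite -ed; apply/idP/idP; apply: nonadjacent_nbrs_twins => //.
by rewrite edge_sym.
Qed.

Lemma co_component_complete x y : x \in K -> y \in a :: A -> y \notin K -> edge x y.
Proof.
case: inv => [[_ _ uA] _] xK yA; apply: contraR => xy.
have h := saturate_closed co_nbr_refl aA uA isT isT xK yA.
by apply: h; rewrite /co_nbr edge_sym xy orbT.
Qed.

Lemma join_cand_indep : indep_in U cand.
Proof.
have [[_ [[uS subS indS] _] _] _] := inv; have [indK _] := optK; have [_ subK _] := indK.
have candS y : y \in [seq y <- S | ~~ closed_nbr a y] -> (y \in D) && ~~ edge a y.
  by rewrite mem_filter negb_or => /andP[/andP[_ ->] /subS->].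
apply: (@indep_in_cat _ _ _ _ D indK).
- split; first exact: filter_uniq.
    by move=> y /candS /andP[].
  by move=> x y; rewrite !mem_filter => /andP[_ xS] /andP[_ yS]; apply: indS.
- by move=> x /KA /and3P[].
- by move=> x; rewrite mem_filter => /andP[].
move=> x y /subK xK /candS /andP[yD nay]; rewrite (co_component_nbrs yD xK) nay andbT.
apply/eqP => e; move: yD; rewrite -e mem_filter negb_or => /andP[/andP[_ /negP]].
by case/and3P: (KA xK).
Qed.

(** A competitor that misses [K] is already beaten by [best]. One that meets [K] has no other
    neighbour of [b], because every other co-component is complete to [K]; it is an independent
    subset of [K] together with non-neighbours of [a] in [D], and [cand] is optimal for both
    parts. *)
Lemma join_step : join_inv [seq y <- a :: A | y \notin K] S (better best cand).
Proof.
have [[indb optS uA] [optb hA compl]] := inv; have indc := join_cand_indep.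
have [[uS subS indS] maxS] := optS; have [indK maxK] := optK.
have [_ subK _] := indK.
have [ge1 ge2] := better_ge best cand.
have DU : {subset D <= U} by move=> x; rewrite mem_filter => /andP[].
have aU : a \in U by case/andP: (hA _ (mem_head _ _)).
have ba : edge b a by case/andP: (hA _ (mem_head _ _)).
have optc J : sub_indep U J -> (forall x, x \in J -> x \in a :: A -> x \in K) ->
    (exists2 z, z \in J & z \in K) -> (weight w J <= wsum cand)%R.
  move=> indJ JK [z zJ zK]; have [JU iJ] := indJ.
  have /and3P[zA zU bz] := KA zK.
  have JD x : x \in J -> x \notin K -> (x \in D) && ~~ edge a x.
    move=> xJ xK; have xD : x \in D.
      rewrite mem_filter JU // andbT; apply/negP => /orP[/eqP e|bx].
        by have := iJ _ _ xJ zJ; rewrite -e bz.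
      (* A neighbour [x] of [b] outside [a :: A] was treated in an earlier round and is adjacent to
         [z]; inside [a :: A] it would lie in [K] by [JK]. *)
      have := iJ _ _ xJ zJ; rewrite compl ?JU //.
      by apply: contra xK; apply: JK.
    by rewrite xD -(co_component_nbrs xD zK); apply: iJ.
  rewrite wsum_cat (weight_split J (mem K)) lerD //.
    by apply: maxK; apply: sub_indep_setI indJ _.
  set J2 := [set x in J | _].
  (* exchange argument: [J2] and the part of [S] adjacent to [a] lie in different
     components of [D] *)
  pose S2 := [set x in S | closed_nbr a x].
  have split_S : wsum S = (weight w S2 + wsum [seq y <- S | ~~ closed_nbr a y])%R.
    rewrite -(weight_seq uS) (weight_split _ (closed_nbr a)); congr (_ + _)%R.
      by congr weight; apply/setP => x; rewrite !inE.
    rewrite -weight_seq ?filter_uniq //; congr weight; apply/setP => x.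
    by rewrite !inE mem_filter andbC.
  have J2D x : x \in J2 -> (x \in D) && ~~ edge a x.
    by rewrite inE => /andP[/JD].
  have S2D x : x \in S2 -> [&& x \in D, x \in S & edge a x].
    rewrite inE => /andP[xS /orP[/eqP e|ax]]; last by rewrite subS // xS.
    by have := subS _ xS; rewrite mem_filter negb_or -e ba andbF.
  have dis : [disjoint S2 & J2].
    apply/pred0P => x /=; apply/negP => /andP[/S2D /and3P[_ _ ax] /J2D /andP[_]].
    by rewrite ax.
  have no_edge x y : x \in S2 -> y \in J2 -> ~~ edge x y.
    move=> /S2D /and3P[xD _ ax] /J2D /andP[yD]; apply: contra.
    by move=> xy; apply: (nbr_separates_components aU ba xD yD).
  have : (weight w (S2 :|: J2) <= wsum S)%R.
    apply: maxS; split=> [x|x y]; rewrite !in_setU.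
      by case/orP=> [/S2D/and3P[]|/J2D/andP[]].
    case/orP=> [xS|xJ] /orP[yS|yJ].
    - by apply: indS; [case/and3P: (S2D _ xS) | case/and3P: (S2D _ yS)].
    - exact: no_edge.
    - by rewrite edge_sym no_edge.
    - by move: xJ yJ; rewrite !inE => /andP[xJ _] /andP[yJ _]; apply: iJ.
  have -> : weight w (S2 :|: J2) = (weight w S2 + weight w J2)%R 
    by rewrite /weight -bigU //; apply: eq_bigl => x; rewrite !inE.
  by rewrite split_S lerD2l.
split; first by split; [apply: better_cases | | rewrite filter_uniq].
split=> [J indJ nJ|x|x y xU bx].
- have [/existsP[z /andP[zJ zK]]|/existsPn noK] := boolP [exists z, (z \in J) && (z \in K)].
    apply: le_trans ge2; apply: optc => //; last by exists z.
    by move=> x xJ xA; have := nJ _ xJ; rewrite mem_filter xA andbT negbK.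
  apply: le_trans ge1; apply: optb => // x xJ; apply/negP => xA.
  have := nJ _ xJ; rewrite mem_filter xA andbT negbK => xK.
  by have := noK x; rewrite xJ xK.
- by rewrite mem_filter => /andP[_ /hA].
rewrite (mem_filter _ x) (mem_filter _ y) negb_and negbK => /orP[xK|xA] /andP[yK yA].
  exact: co_component_complete xK yA yK.
exact: compl.
Qed.

End Step.
End Join.
End Optimum.

(** * Correctness and running time *)

Section Main.
Variables (k : nat) (G : sgraph) (w : G -> rat).
Hypothesis w0 : forall x, (0 <= w x)%R.
Let c := 4 * k + 2.
Let r := 4 * k.
Let b := #|G| + r + c + 1000.
Let p := mis_program c r.
Let encg := encode_graph w.
Notation encl := (encode_seq (@encode_vertex G)).
Notation encll := (encode_seq (encode_seq (@encode_vertex G))).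
Implicit Types (U S A K : seq G) (Ps : seq (seq G)).

Let hb : #|G| + r + c + 1000 <= b. Proof. exact: leqnn. Qed.

Definition enc_res (o : option (seq G)) : value :=
  if o is Some s then Cons (Num 1) (encl s) else Num 0.

Lemma runs_better (f : seq G -> value) env W1 W2 E1 E2 s1 s2 T1 T2 T :
  runs p env W1 (Wgt (wsum w s1)) T1 -> runs p env W2 (Wgt (wsum w s2)) T2 ->
  runs p env E1 (f s1) T -> runs p env E2 (f s2) T ->
  runs p env (If (leq_ W1 W2) E2 E1) (f (better w s1 s2)) ((T1 + T2).+1 + T).+1.
Proof.
move=> h1 h2 h3 h4; apply: (@runs_if _ _ _ _ _ (wsum w s1 <= wsum w s2)%R).
- by eapply runs_op2; [exact: h1 | exact: h2 | reflexivity].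
- by rewrite /better => ->.
- by rewrite /better => /negbTE->.
Qed.

(** The result is described only by what it satisfies. No functional model of the mutual recursion
    is needed: termination is proved by the same induction as the time bound. *)
Definition solves body arg U (Q : Prop) T := exists o,
  [/\ runs p [:: arg] body (enc_res o) T,
      forall S, o = Some S -> optimal w U S & Q -> o <> None].

Lemma runs_ifT env e e1 e2 (t : bool) v T T' :
  runs p env e (Num t) T -> t -> runs p env e1 v T' -> runs p env (If e e1 e2) v (T + T').+1.
Proof. by move=> h ht h1; apply: runs_if h _ _ => //; rewrite ht. Qed.

Lemma runs_ifF env e e1 e2 (t : bool) v T T' :
  runs p env e (Num t) T -> ~~ t -> runs p env e2 v T' -> runs p env (If e e1 e2) v (T + T').+1.
Proof. by move=> h ht h1; apply: runs_if h _ _ => //; rewrite (negbTE ht). Qed.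

Lemma uniq_size U : uniq U -> size U <= #|G|.
Proof. by move/card_uniqP <-; apply: max_card. Qed.

Lemma uniq_size4 U : uniq U -> size U <= #|G| + r + 4.
Proof. by move/uniq_size => h; rewrite -addnA (leq_trans h) ?leq_addr. Qed.

Lemma size_filter_notin A K : uniq A -> uniq K -> {subset K <= A} ->
  size [seq y <- A | y \notin K] + size K = size A.
Proof.
move=> uA uK sub; rewrite !size_filter -(count_predC (mem K) A) addnC; congr (_ + _).
rewrite -size_filter; apply/esym/perm_size/uniq_perm => //; first exact: filter_uniq.
by move=> x; rewrite mem_filter; apply/andP/idP => [[]|xK] //; split; [exact: xK | exact: sub].
Qed.

Lemma b_le m n : m <= n -> b ^ m <= b ^ n.
Proof. by apply: leq_pexp2l; rewrite /b addnS. Qed.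

(** Pays for the work of one call outside its recursive calls. The largest items are the enumeration
    of [r]-tuples, [b ^ r.+3], and the search for heavy vertices, [b ^ 17]. *)
Let Q0 := b ^ (r + 20).

Lemma b_ge m : m <= r + 20 -> b ^ m <= Q0.
Proof. exact: b_le. Qed.

Lemma Q0_ge : 1000 * b ^ 19 <= Q0.
Proof. apply: leq_trans (b_pow hb 19) _; apply: b_ge; lia. Qed.

(* [splittable] and [branchable] below are sufficient for [split] and [branch] not to fail;
   in both, [B] is the unknown balanced bag. *)
Definition splittable s U := has_good_bags G k /\
  exists B : {set G}, balances s B U /\ {in p4s U, forall P, ~~ has (mem B) P}.

Lemma p4s_sub U U' P : {subset U <= U'} -> P \in p4s U -> P \in p4s U'.
Proof.
move=> sub; rewrite !mem_filter => /andP[-> /tuplesP[sP PU]]; rewrite andTb.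
by apply/tuplesP; split => // x /PU /sub.
Qed.

Lemma balances_sub s B U U' : {subset U <= U'} -> balances s B U' -> balances s B U.
Proof. by move=> sub bal C hC; apply: bal => x /hC /andP[/sub -> ->]. Qed.

Lemma splittable_sub s U U' : {subset U <= U'} -> splittable s U' -> splittable s U.
Proof.
move=> sub [good [B [bal no]]]; split=> //; exists B; split; first exact: balances_sub bal.
by move=> P /(p4s_sub sub); apply: no.
Qed.

(** Without a P4-free vertex, every vertex of [U] lies on a P4 and so outside [B]; then the
    connected set [U] itself falls under the balance condition. *)
Lemma splittable_connected s U : splittable s U -> connected_set [set x in U] -> uniq U ->
  s < size U + size U -> has (p4_free (p4s U)) U.
Proof.
move=> [_ [B [bal no]]] con uU big; apply: contraTT big => /hasPn nfree.
rewrite -leqNgt -(card_uniqP uU) -[#|U|]cardsE; apply: bal con => x; rewrite inE => xU.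
rewrite xU /=; apply: contra (nfree _ xU) => xB; apply/hasPn => P /no; apply: contra => xP.
by apply/hasP; exists x.
Qed.

(** [T] is the cost of a recursive call to [solve]. The subtracted 1 leaves one unit [Q0 + T] for
    the overhead whenever a set is cut into two nonempty parts. An empty set still costs one unit,
    for its own call to [solve]. *)
Definition split_cost T n := (Q0 + T) * (if n == 0 then 1 else 4 * n - 1).

Lemma split_costE T n : 0 < n -> split_cost T n + (Q0 + T) = (Q0 + T) * (4 * n).
Proof.
move=> n0; rewrite /split_cost eqn0Ngt n0 /= -mulnSr; congr (_ * _); lia.
Qed.

Definition split_arg s U := Cons encg (Cons (encl U) (Num s)).

(** * Running the recombination around a vertex on no P4 *)

Section Join.
Variables (s T n : nat) (U : seq G) (v : G).
Hypotheses (uU : uniq U) (vU : v \in U) (freev : p4_free (p4s U) v).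
Hypothesis split_ok : forall K, uniq K -> size K <= n ->
  solves split_body (split_arg s K) K (splittable s K) (split_cost T (size K)).

(** The cost is charged to the disjoint co-components: a call on [K] with its overhead fits into
    [(Q0 + T) * (4 * size K)]. The list [S] passed along is the solution on the non-neighbours of
    [v], computed once. *)
Lemma join_solves A S best : join_inv w U v A S best -> size A <= n ->
  solves join_body (Cons (encl A) (Cons (encl S) (Cons (encl best) (Cons encg (Num s)))))
    U (splittable s U) ((Q0 + T) * (4 * size A) + 100).
Proof.
move: {2}(size A) (leqnn (size A)) => m; elim: m A best => [|m IHm] [|a A] best // le inv hA.
1,2: exists (Some best); split=> // [|S' [<-]]; last exact: join_end inv.
1,2: apply: runs_le; first (eapply (@runs_ifF _ _ _ _ false); [ev | by [] | ev]).
1,2: by rewrite /=; lia.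
set K := saturate (@co_nbr G) (a :: A) [:: a] (size (a :: A)).
have [[[ub _ _] [[uS _ _] _] uA] [_ inU _]] := inv.
have aA : {subset [:: a] <= a :: A} by move=> x; rewrite !inE => ->.
have KA : {subset K <= a :: A} by apply: saturate_sub.
have uK : uniq K by apply: saturate_uniq.
have aK : a \in K.
  exact: (@saturate_base G (@co_nbr G) (a :: A) (@co_nbr_refl G) [:: a] (size (a :: A)) aA a (mem_head _ _)).
have sK : 0 < size K by case: (K) aK.
have szA := size_filter_notin uA uK KA.
set A' := [seq y <- _ | _] in szA.
have sizeK : size K <= size (a :: A) by rewrite -szA leq_addl.
have [oK [runK optK complK]] := split_ok uK (leq_trans sizeK hA).
have KU : {subset K <= U} by move=> x /KA /inU /andP[].
have szub := uniq_size4 ub; have szuA := uniq_size4 uA; have szuS := uniq_size4 uS.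
have szuK := uniq_size4 uK.
have h1 : size [:: a] <= #|G| + r + 4 by rewrite addnS.
have runC : runs p [:: Cons (encl (a :: A)) (Cons (encl S) (Cons (encl best) (Cons encg (Num s))))]
    (Call f_co_component (cons_ (fst_ (snd_ (snd_ (snd_ (Var 0))))) (cons_ (fst_ (Var 0))
       (cons_ (singleton_ (fst_ (fst_ (Var 0)))) (fst_ (Var 0)))))) (encl K) (20 + b ^ 9).
  apply: runs_le.
    by apply: (@runs_co_component c r b G w hb _ _ (a :: A) [:: a] (a :: A)) => //; ev.
  by clear; lia.
case: oK runK optK complK => [SK|] runK optK complK; last first.
  exists None; split=> // [|spl]; last by case: (complK (splittable_sub KU spl)).
  apply: runs_le.
    eapply (@runs_ifT _ _ _ _ true); [ev | by [] | ].
    eapply runs_let; first exact: runC.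
    eapply runs_let.
      by apply: (runs_call (body := split_body)) runK => //; ev.
    by eapply (@runs_ifF _ _ _ _ false); [ev | by [] | ev].
  have e := split_costE T sK; have := b_le (isT : 9 <= 19); have := Q0_ge.
  have : (Q0 + T) * (4 * size K) <= (Q0 + T) * (4 * size (a :: A)) by rewrite !leq_mul2l sizeK !orbT.
  have := b_gt0 hb 19; move: e.
  move: ((Q0 + T) * (4 * size K)) ((Q0 + T) * (4 * size (a :: A))) (split_cost T (size K)).
  move: (Q0) (b ^ 19) (b ^ 9); clear; lia.
have {}optK := optK _ erefl.
set cand := SK ++ [seq y <- S | ~~ closed_nbr a y].
have inv' := join_step vU freev inv optK.
rewrite -/K -/A' in inv'.
have leA' : size A' <= m by move: le szA sK => /=; clear; lia.
have hA' : size A' <= n by move: hA szA => /=; clear; lia.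
have [o [runo opto complo]] := IHm A' _ leA' inv' hA'.
exists o; split=> //.
have runN : runs p [:: Cons (Num 1) (encl SK); encl K;
      Cons (encl (a :: A)) (Cons (encl S) (Cons (encl best) (Cons encg (Num s))))]
    (Call f_append (cons_ (snd_ (Var 0)) (Call f_non_nbr (cons_ (cons_
      (fst_ (snd_ (snd_ (snd_ (Var 2))))) (fst_ (fst_ (Var 2)))) (fst_ (snd_ (Var 2)))))))
    (encl cand) (50 + b ^ 4 + b ^ 2).
  have szuSK : size SK <= #|G| + r + 4 by apply: uniq_size4; have [[]] := optK.
  apply: runs_le.
    apply: (@runs_app c r b G hb) => //; eapply runs_op2; [by ev | | reflexivity].
    by apply: (@runs_non_nbr c r b G w hb) => //; ev.
  by clear; lia.
have szuc : size cand <= #|G| + r + 4.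
  by apply: uniq_size4; have [] := join_cand_indep vU freev inv optK.
apply: runs_le.
  eapply (@runs_ifT _ _ _ _ true); [ev | by [] | ].
  eapply runs_let; first exact: runC.
  eapply runs_let.
    by apply: (runs_call (body := split_body)) runK => //; ev.
  eapply (@runs_ifT _ _ _ _ true); [ev | by [] | ].
  eapply runs_let; first exact: runN.
  eapply runs_let.
    apply: (@runs_better (fun s => encl s) _ _ _ _ _ best cand).
    - by apply: (@runs_weight c r b G w hb) => //; ev.
    - by apply: (@runs_weight c r b G w hb) => //; ev.
    - by ev.
    - by apply: runs_le; [ev | clear; lia].
  apply: (runs_call (body := join_body)) runo => //.
  eapply runs_op2; [ | by ev | reflexivity].
  by apply: (@runs_diff c r b G hb _ _ K) => //; ev.
have e := split_costE T sK; have := b_le (isT : 9 <= 19); have := b_le (isT : 4 <= 19).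
have := b_le (isT : 2 <= 19); have := Q0_ge; have := b_gt0 hb 19; move: e.
have -> : (Q0 + T) * (4 * size (a :: A)) = (Q0 + T) * (4 * size K) + (Q0 + T) * (4 * size A').
  by rewrite -szA !mulnDr addnC.
move: ((Q0 + T) * (4 * size K)) ((Q0 + T) * (4 * size A')) (split_cost T (size K)).
move: (Q0) (b ^ 19) (b ^ 9) (b ^ 4) (b ^ 2); clear; lia.
Qed.
End Join.

(** * Splitting down to half the size *)

Definition solve_ok l T := forall U, uniq U -> size U <= 2 ^ l ->
  solves solve_body (Cons encg (encl U)) U (has_good_bags G k) T.

Lemma split_cost_ge T n : Q0 + T <= split_cost T n.
Proof. by rewrite /split_cost -[X in X <= _]muln1 leq_mul2l; apply/orP; right; case: n => // n; rewrite mulnS addSn subn1. Qed.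

(** Strict, because [v] itself is counted on neither side; [split_solves] draws its slack from this
    vertex. *)
Lemma size_nbrs U v : uniq U -> v \in U ->
  size [seq y <- U | ~~ closed_nbr v y] + size (filter (edge v) U) < size U.
Proof.
move=> uU vU; rewrite !size_filter -(count_predC (closed_nbr v) U) addnC ltn_add2r.
have -> : count (closed_nbr v) U = count (predU (pred1 v) (edge v)) U.
  by apply: eq_count => y /=; rewrite /closed_nbr eq_sym.
have : count (predI (pred1 v) (edge v)) U = 0.
  by apply/eqP; rewrite -leqn0 leqNgt -has_count; apply/hasPn => y _ /=; apply/negP => /andP[/eqP->]; rewrite edge_irr.
move=> I0; have := count_predUI (pred1 v) (edge v) U.
by rewrite I0 addn0 (count_uniq_mem v uU) vU add1n => ->.
Qed.

Lemma closed_nbr_refl : reflexive (@closed_nbr G).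
Proof. by move=> x; rewrite /closed_nbr eqxx. Qed.

Lemma component_connected U x n : x \in U ->
  {subset U <= saturate (@closed_nbr G) U [:: x] n} -> connected_set [set z in U].
Proof.
move=> xU sub.
set e := [rel u v | [&& u \in [set z in U], v \in [set z in U] & edge u v]].
have syme : connect_sym e by apply: sym_connect_sym => u v; rewrite /e /= edge_sym andbCA.
suff h y : y \in U -> connect e x y.
  move=> y z; rewrite !inE => yU zU; apply: (@connect_trans _ _ x); last exact: h.
  by rewrite syme; apply: h.
move=> /sub; apply: (saturate_ind (Q := connect e x)) => [z|y' z y'U xy' zU|z].
- by rewrite inE => /eqP->; apply: connect0.
- rewrite /closed_nbr => /orP[/eqP->//|zy']; apply: connect_trans xy' (connect1 _).
  by rewrite /e /= !inE y'U zU edge_sym.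
- by rewrite inE => /eqP->.
Qed.

Lemma runs_small_test s U : uniq U -> runs p [:: split_arg s U]
    (leq_ (add_ (Call f_length (fst_ (snd_ (Var 0)))) (Call f_length (fst_ (snd_ (Var 0)))))
       (snd_ (snd_ (Var 0)))) (Num (size U + size U <= s)) (2 * b ^ 2 + 30).
Proof.
move=> /uniq_size4 szU.
have h : runs p [:: split_arg s U] (Call f_length (fst_ (snd_ (Var 0)))) (Num (size U)) (b ^ 2 + 10).
  by apply: runs_le; [apply: (@runs_len c r b G hb _ _ U) => //; ev | clear; lia].
apply: runs_le.
  by eapply runs_op2; [eapply runs_op2; [exact: h | exact: h | reflexivity] | ev | reflexivity].
by clear; lia.
Qed.

Lemma split_small l T s U : s <= 2 ^ l.+1 -> solve_ok l T -> uniq U ->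
  size U + size U <= s ->
  solves split_body (split_arg s U) U (splittable s U) (split_cost T (size U)).
Proof.
move=> hs ok uU le.
have hU : size U <= 2 ^ l by move: le hs; rewrite expnS; clear; lia.
have [o [runo opto complo]] := ok U uU hU.
exists o; split=> // [|[good _]]; last exact: complo.
apply: (@runs_le _ _ _ _ (Q0 + T)); last exact: split_cost_ge.
have szU := uniq_size4 uU.
apply: runs_le.
  eapply (@runs_ifT _ _ _ _ (size U + size U <= s)).
  - exact: runs_small_test.
  - by [].
  by apply: (runs_call (body := solve_body)) runo => //; ev.
have := Q0_ge; have := b_le (isT : 2 <= 19); have := b_gt0 hb 19.
by move: (Q0) (b ^ 19) (b ^ 2); clear; lia.
Qed.

Lemma split_solves l T s n U : s <= 2 ^ l.+1 -> solve_ok l T -> uniq U -> size U <= n ->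
  solves split_body (split_arg s U) U (splittable s U) (split_cost T (size U)).
Proof.
move=> hs ok; elim: n U => [|n IHn] U uU hU.
  by move: hU; rewrite leqn0 size_eq0 => /eqP E; apply: split_small hs ok uU _; rewrite E.
have [le|lt] := leqP (size U + size U) s; first exact: split_small hs ok uU le.
case: U uU hU lt => // x U' uxU hU lt; set U := x :: U' in uxU hU lt *.
have xU : x \in U by exact: mem_head.
have xsub : {subset [:: x] <= U} by move=> z; rewrite inE => /eqP->.
set C := saturate (@closed_nbr G) U [:: x] (size U).
have CU : {subset C <= U} by apply: saturate_sub.
have uC : uniq C by apply: saturate_uniq.
have xC : x \in C.
  exact: (@saturate_base G (@closed_nbr G) U closed_nbr_refl [:: x] (size U) xsub x (mem_head _ _)).
have sC : 0 < size C by case: (C) xC.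
set R := [seq y <- U | y \notin C].
have uR : uniq R by apply: filter_uniq.
have RU : {subset R <= U} by move=> z; rewrite mem_filter => /andP[].
have szR : size R + size C = size U by exact: size_filter_notin.
have szU := uniq_size4 uxU; have szC := uniq_size4 uC; have szuR := uniq_size4 uR.
have h1 : size [:: x] <= #|G| + r + 4 by rewrite addnS.
have runlt : runs p [:: split_arg s U]
    (leq_ (add_ (Call f_length (fst_ (snd_ (Var 0)))) (Call f_length (fst_ (snd_ (Var 0)))))
       (snd_ (snd_ (Var 0)))) (Num (size U + size U <= s)) (2 * b ^ 2 + 30).
  exact: runs_small_test.
have runC : runs p [:: split_arg s U] (Call f_component (cons_ (fst_ (Var 0))
    (cons_ (fst_ (snd_ (Var 0))) (cons_ (singleton_ (fst_ (fst_ (snd_ (Var 0)))))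
    (fst_ (snd_ (Var 0))))))) (encl C) (20 + b ^ 9).
  apply: runs_le.
    by apply: (@runs_component c r b G w hb _ _ U [:: x] U) => //; ev.
  by clear; lia.
have runR : runs p [:: encl C; split_arg s U]
    (Call f_diff (cons_ (Var 0) (fst_ (snd_ (Var 1))))) (encl R) (20 + b ^ 4).
  apply: runs_le; first by apply: (@runs_diff c r b G hb _ _ C) => //; ev.
  by clear; lia.
have notle : ~~ (size U + size U <= s) by rewrite -ltnNge.
have := Q0_ge; have := b_le (isT : 9 <= 19); have := b_le (isT : 4 <= 19).
have := b_le (isT : 11 <= 19); have := b_le (isT : 2 <= 19); have := b_gt0 hb 19.
move=> q0 q2 q11 q4 q9 qQ.
(* An empty remainder means that [U] is connected, so that a P4-free vertex is needed for further
   splitting. *)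
case ER : R => [|y R'].
  have szRC : size U = size C by rewrite -szR ER.
  have UC : {subset U <= C} by have [] := uniq_min_size uC CU (_ : size U <= size C); rewrite ?szRC // => _ h z; rewrite h.
  have con : connected_set [set z in U] by apply: component_connected xU UC.
  have runF : runs p [:: encl R; encl C; split_arg s U]
      (Call f_p4_free (cons_ (p4s_ (fst_ (Var 2)) (fst_ (snd_ (Var 2)))) (fst_ (snd_ (Var 2)))))
      (encl (filter (p4_free (p4s U)) U)) (20 + b ^ 11 + b ^ 11).
    have vp := valid_p4s_tuples hb szU.
    apply: runs_le.
      apply: (@runs_p4_free c r b G hb _ _ (p4s U)) => //.
      eapply runs_op2; [ | by ev | reflexivity].
      by apply: (@runs_p4s c r b G w hb) => //; ev.
    by clear; lia.
  case EF : (filter (p4_free (p4s U)) U) runF => [|v bs] runF.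
    exists None; split=> // [|spl]; last first.
      by have := splittable_connected spl con uxU lt; rewrite has_filter EF.
    apply: (@runs_le _ _ _ _ (Q0 + T)); last exact: split_cost_ge.
    apply: runs_le.
      eapply (@runs_ifF _ _ _ _ (size U + size U <= s)); [exact: runlt | by [] | ].
      eapply runs_let; first exact: runC.
      eapply runs_let; first exact: runR.
      eapply (@runs_ifF _ _ _ _ false); [by rewrite ER; ev | by [] | ].
      eapply runs_let; first exact: runF.
      by eapply (@runs_ifF _ _ _ _ false); [ev | by [] | ev].
    move: q0 q2 q11 q4 q9 qQ.
    by move: (b ^ 19) (b ^ 2) (b ^ 9) (b ^ 4) (b ^ 11) (Q0); clear; lia.
  have [freev vU] : p4_free (p4s U) v /\ v \in U.
    by apply/andP; rewrite -mem_filter EF mem_head.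
  set D := [seq z <- U | ~~ closed_nbr v z].
  set A := filter (edge v) U.
  have szDA : size D + size A < size U by apply: size_nbrs.
  have uD : uniq D by apply: filter_uniq.
  have hD : size D <= n by move: szDA hU; clear; lia.
  have hA : size A <= n by move: szDA hU; clear; lia.
  have DU : {subset D <= U} by move=> z; rewrite mem_filter => /andP[].
  have [oD [runoD optD complD]] := IHn D uD hD.
  have runD : runs p [:: encode_vertex v; encl (v :: bs); encl R; encl C; split_arg s U]
      (cons_ (fst_ (Var 4)) (cons_ (Call f_non_nbr (cons_ (cons_ (fst_ (Var 4)) (Var 0))
        (fst_ (snd_ (Var 4))))) (snd_ (snd_ (Var 4))))) (split_arg s D) (40 + b ^ 4).
    apply: runs_le.
      eapply runs_op2; [by ev | | reflexivity].
      eapply runs_op2; [ | by ev | reflexivity].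
      by apply: (@runs_non_nbr c r b G w hb) => //; ev.
    by clear; lia.
  (* The vertex [v] lies neither in [D] nor in [A]. The four units [Q0 + T] that it frees pay for a
     possibly empty [D] and for the overhead. *)
  have costs : split_cost T (size D) + (Q0 + T) * (4 * size A) + (Q0 + T) <= split_cost T (size U).
    have U0 : 0 < size U by [].
    have e := split_costE T U0.
    have e1 : split_cost T (size D) <= (Q0 + T) * (4 * size D + 1).
      by rewrite leq_mul2l; apply/orP; right; case: (size D) => // m /=; clear; lia.
    have e2 : (Q0 + T) * (4 * size D + 1) + (Q0 + T) * (4 * size A) + (Q0 + T) + (Q0 + T)
        <= (Q0 + T) * (4 * size U).
      rewrite -mulnDr -2!mulnSr leq_mul2l; apply/orP; right.
      by move: szDA; clear; lia.
    move: e e1 e2; move: ((Q0 + T) * (4 * size D + 1)) ((Q0 + T) * (4 * size A)).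
    move: ((Q0 + T) * (4 * size U)) (split_cost T (size D)) (split_cost T (size U)).
    by move: (Q0 + T); clear; lia.
  case: oD runoD optD complD => [SD|] runoD optD complD; last first.
    exists None; split=> // [|spl]; last by case: (complD (splittable_sub DU spl)).
    apply: runs_le.
      eapply (@runs_ifF _ _ _ _ (size U + size U <= s)); [exact: runlt | by [] | ].
      eapply runs_let; first exact: runC.
      eapply runs_let; first exact: runR.
      eapply (@runs_ifF _ _ _ _ false); [by rewrite ER; ev | by [] | ].
      eapply runs_let; first exact: runF.
      eapply (@runs_ifT _ _ _ _ true); [by ev | by [] | ].
      eapply runs_let; first by ev.
      eapply runs_let.
        by apply: (runs_call (body := split_body)) runoD => //; exact: runD.
      by eapply (@runs_ifF _ _ _ _ false); [ev | by [] | ev].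
    move: q0 q2 q11 q4 q9 qQ costs; move: ((Q0 + T) * (4 * size A)).
    move: (split_cost T (size D)) (split_cost T (size U)) (Q0).
    by move: (b ^ 19) (b ^ 2) (b ^ 9) (b ^ 4) (b ^ 11); clear; lia.
  have {}optD := optD _ erefl.
  have inv := join_start w0 vU uxU optD.
  have [o [runo opto complo]] := join_solves uxU vU freev IHn inv hA.
  exists o; split=> //.
  apply: runs_le.
    eapply (@runs_ifF _ _ _ _ (size U + size U <= s)); [exact: runlt | by [] | ].
    eapply runs_let; first exact: runC.
    eapply runs_let; first exact: runR.
    eapply (@runs_ifF _ _ _ _ false); [by rewrite ER; ev | by [] | ].
    eapply runs_let; first exact: runF.
    eapply (@runs_ifT _ _ _ _ true); [by ev | by [] | ].
    eapply runs_let; first by ev.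
    eapply runs_let.
      by apply: (runs_call (body := split_body)) runoD => //; exact: runD.
    eapply (@runs_ifT _ _ _ _ true); [by ev | by [] | ].
    apply: (runs_call (body := join_body)) runo => //.
    eapply runs_op2; [ | by ev | reflexivity].
    by apply: (@runs_open_nbr c r b G w hb) => //; ev.
  move: q0 q2 q11 q4 q9 qQ costs; move: ((Q0 + T) * (4 * size A)).
  move: (split_cost T (size D)) (split_cost T (size U)) (Q0).
  by move: (b ^ 19) (b ^ 2) (b ^ 9) (b ^ 4) (b ^ 11); clear; lia.
have sR : 0 < size R by rewrite ER.
have hC : size C <= n by move: szR hU sR; clear; lia.
have hR : size R <= n by move: szR hU sC; clear; lia.
have [oC [runoC optC complC]] := IHn C uC hC.
have [oR [runoR optR complR]] := IHn R uR hR.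
have costs : split_cost T (size C) + split_cost T (size R) + (Q0 + T) + (Q0 + T) <= split_cost T (size U) + (Q0 + T).
  have e : (Q0 + T) * (4 * size C) + (Q0 + T) * (4 * size R) = (Q0 + T) * (4 * size U).
    by rewrite -szR !mulnDr addnC.
  rewrite [X in _ <= X]split_costE // -e -(split_costE T sC) -(split_costE T sR).
  by move: (split_cost T (size C)) (split_cost T (size R)) (Q0); clear; lia.
case: oC runoC optC complC => [SC|] runoC optC complC; last first.
  exists None; split=> // [|spl]; last by case: (complC (splittable_sub CU spl)).
  apply: runs_le.
    eapply (@runs_ifF _ _ _ _ (size U + size U <= s)); [exact: runlt | by [] | ].
    eapply runs_let; first exact: runC.
    eapply runs_let; first exact: runR.
    eapply (@runs_ifT _ _ _ _ true); [by rewrite ER; ev | by [] | ].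
    eapply runs_let.
      by apply: (runs_call (body := split_body)) runoC => //; ev.
    by eapply (@runs_ifF _ _ _ _ false); [ev | by [] | ev].
  move: q0 q2 q11 q4 q9 qQ costs.
  move: (split_cost T (size C)) (split_cost T (size R)) (split_cost T (size U)) (Q0).
  by move: (b ^ 19) (b ^ 2) (b ^ 9) (b ^ 4) (b ^ 11); clear; lia.
case: oR runoR optR complR => [SR|] runoR optR complR; last first.
  exists None; split=> // [|spl]; last by case: (complR (splittable_sub RU spl)).
  apply: runs_le.
    eapply (@runs_ifF _ _ _ _ (size U + size U <= s)); [exact: runlt | by [] | ].
    eapply runs_let; first exact: runC.
    eapply runs_let; first exact: runR.
    eapply (@runs_ifT _ _ _ _ true); [by rewrite ER; ev | by [] | ].
    eapply runs_let.
      by apply: (runs_call (body := split_body)) runoC => //; ev.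
    eapply (@runs_ifT _ _ _ _ true); [by ev | by [] | ].
    eapply runs_let.
      by apply: (runs_call (body := split_body)) runoR => //; ev.
    by eapply (@runs_ifF _ _ _ _ false); [ev | by [] | ev].
  move: q0 q2 q11 q4 q9 qQ costs.
  move: (split_cost T (size C)) (split_cost T (size R)) (split_cost T (size U)) (Q0).
  by move: (b ^ 19) (b ^ 2) (b ^ 9) (b ^ 4) (b ^ 11); clear; lia.
have {}optC := optC _ erefl; have {}optR := optR _ erefl.
exists (Some (SC ++ SR)); split=> // [|S' [<-]]; last first.
  apply: optimal_union CU _ optC optR => u v uC' vU uv.
  have h := saturate_closed closed_nbr_refl xsub uxU isT isT uC' vU; apply: h.
  by rewrite /closed_nbr edge_sym uv orbT.
apply: runs_le.
  eapply (@runs_ifF _ _ _ _ (size U + size U <= s)); [exact: runlt | by [] | ].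
  eapply runs_let; first exact: runC.
  eapply runs_let; first exact: runR.
  eapply (@runs_ifT _ _ _ _ true); [by rewrite ER; ev | by [] | ].
  eapply runs_let.
    by apply: (runs_call (body := split_body)) runoC => //; ev.
  eapply (@runs_ifT _ _ _ _ true); [by ev | by [] | ].
  eapply runs_let.
    by apply: (runs_call (body := split_body)) runoR => //; ev.
  eapply (@runs_ifT _ _ _ _ true); [by ev | by [] | ].
  eapply runs_op2; [by ev | | reflexivity].
  by apply: (@runs_app c r b G hb) => //; [apply: uniq_size4; have [[]] := optC | ev].
move: q0 q2 q11 q4 q9 qQ costs.
move: (split_cost T (size C)) (split_cost T (size R)) (split_cost T (size U)) (Q0).
by move: (b ^ 19) (b ^ 2) (b ^ 9) (b ^ 4) (b ^ 11); clear; lia.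
Qed.

(** * Branching and guessing until the list of P4s is empty *)

Lemma size_touched U X Ps : {in U, forall x, ~~ heavy c Ps x} -> {subset X <= U} ->
  c * size (filter (touched X) Ps) <= size X * size Ps.
Proof.
move=> light; elim: X => [|x X IHX] sub.
  have -> : filter (touched [::]) Ps = [::]; last by rewrite muln0.
  by elim: Ps {light} => //= P Ps ->; have -> : touched [::] P = false by elim: P.
have hX : {subset X <= U} by move=> y yX; apply: sub; rewrite inE yX orbT.
have : size (filter (touched (x :: X)) Ps)
    <= size (filter (touched [:: x]) Ps) + size (filter (touched X) Ps).
  rewrite !size_filter.
  have -> : count (touched (x :: X)) Ps = count (predU (touched [:: x]) (touched X)) Ps.
    apply: eq_count => P; rewrite /touched /= -has_predU; apply: eq_has => y.
    by rewrite /near /= orbF.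
  by rewrite -count_predUI leq_addr.
have := IHX hX; have := light x (sub _ (mem_head _ _)); rewrite /heavy -ltnNge /= mulSn.
by move: (c) (size _) (size _) (size _) (size Ps) (size X * _) => *; nia.
Qed.

(** As [c] is [d + 1], the same factor d/c serves both reductions: a heavy vertex leaves at most a 1
    - 1/c fraction untouched, and [4 * k] light vertices touch at most a 4k/c fraction. The summand
    1 keeps [d] positive for [k = 0]. *)
Let d := 4 * k + 1.

(* The invariant [size Ps * d ^ j < c ^ j] says that [j] further reductions of [Ps]
   by the factor [d / c] empty it. *)
Lemma geometric_drop m m' j : c * m' <= d * m -> m * d ^ j.+1 < c ^ j.+1 -> m' * d ^ j < c ^ j.
Proof.
have c0 : 0 < c by rewrite /c addnS.
move=> le lt; rewrite -(ltn_pmul2l c0) -expnS; apply: leq_ltn_trans lt.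
by rewrite mulnA (expnS d) mulnA [m * d]mulnC leq_mul2r le orbT.
Qed.

Definition branchable s U Ps := has_good_bags G k /\ exists B : {set G},
  [/\ no_packing k B, balances s B U & {in p4s U, forall P, has (mem B) P -> P \in Ps}].

Definition branch_arg s U Ps := Cons encg (Cons (encl U) (Cons (encll Ps) (Num s))).

Lemma branchable_sub s U U' Ps Ps' : {subset U' <= U} ->
  {in p4s U', forall P, P \in Ps -> P \in Ps'} -> branchable s U Ps -> branchable s U' Ps'.
Proof.
move=> sub h [good [B [npk bal hB]]]; split=> //; exists B; split=> //.
  exact: balances_sub bal.
by move=> P P4 PB; apply: h => //; apply: hB => //; apply: p4s_sub sub P4.
Qed.

Lemma branchable_nil s U : branchable s U [::] -> splittable s U.
Proof.
move=> [good [B [npk bal hB]]]; split=> //; exists B; split=> // P P4.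
by apply/negP => /(hB _ P4).
Qed.

Lemma branchable_guess s U Ps : U != [::] -> branchable s U Ps ->
  exists2 X, X \in tuples U r & branchable s U (filter (touched X) Ps).
Proof.
move=> U0 [good [B [npk bal hB]]].
have hQ : {in [seq P <- p4s U | has (mem B) P], forall P,
    [&& is_p4 P, has (mem B) P & all (mem U) P]}.
  move=> P; rewrite mem_filter => /andP[PB]; rewrite mem_filter => /andP[-> /tuplesP[_ PU]].
  by rewrite PB; apply/allP.
have [X XU hX] := guess_exists npk hQ U0.
exists X => //; split=> //; exists B; split=> // P P4 PB.
by rewrite mem_filter hB // hX // mem_filter PB.
Qed.

Lemma guess_solves s U Ps (Xs : seq (seq G)) C : uniq U -> valid_p4s b Ps ->
  {in Xs, forall X, size X <= #|G| + r + 4} ->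
  {in Xs, forall X, solves (branch_body r) (branch_arg s U (filter (touched X) Ps)) U
     (branchable s U (filter (touched X) Ps)) C} ->
  solves guess_body (Cons (encll Xs) (branch_arg s U Ps)) U
    (exists2 X, X \in Xs & branchable s U (filter (touched X) Ps))
    (size Xs * (C + b ^ 14 + 100) + 20).
Proof.
move=> uU vPs; elim: Xs => [|X Xs IHXs] sX hX.
  exists None; split=> // [|[]//].
  by apply: runs_le; [eapply (@runs_ifF _ _ _ _ false); [ev | by [] | ev] | clear; lia].
have XX : X \in X :: Xs by exact: mem_head.
have [o [runo opto complo]] := hX _ XX.
have runA : runs p [:: Cons (encll (X :: Xs)) (branch_arg s U Ps)]
    (cons_ (fst_ (snd_ (Var 0))) (cons_ (fst_ (snd_ (snd_ (Var 0)))) (cons_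
      (Call f_touched (cons_ (cons_ (fst_ (snd_ (Var 0))) (fst_ (fst_ (Var 0))))
         (fst_ (snd_ (snd_ (snd_ (Var 0)))))))
      (snd_ (snd_ (snd_ (snd_ (Var 0))))))))
    (branch_arg s U (filter (touched X) Ps)) (b ^ 14 + 50).
  apply: runs_le.
    eapply runs_op2; [by ev | | reflexivity].
    eapply runs_op2; [by ev | | reflexivity].
    eapply runs_op2; [ | by ev | reflexivity].
    by apply: (@runs_touched c r b G w hb _ _ X) => //; [exact: sX | ev].
  by clear; lia.
case: o runo opto complo => [S'|] runo opto complo.
  exists (Some S'); split=> //.
  apply: runs_le.
    eapply (@runs_ifT _ _ _ _ true); [ev | by [] | ].
    eapply runs_let; first by apply: (runs_call (body := branch_body r)) runA runo.
    by eapply (@runs_ifT _ _ _ _ true); [ev | by [] | ev].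
  by rewrite (mulSn (size Xs)); move: (size Xs * (C + b ^ 14 + 100)) (b ^ 14); clear; lia.
have [o [runo' opto' complo']] := IHXs (fun Y YX => sX Y (mem_behead (s := _ :: _) YX))
  (fun Y YX => hX Y (mem_behead (s := _ :: _) YX)).
exists o; split=> // [|[Y]]; last first.
  by rewrite inE => /orP[/eqP->|YX] hY; [case: (complo hY) | apply: complo'; exists Y].
apply: runs_le.
  eapply (@runs_ifT _ _ _ _ true); [ev | by [] | ].
  eapply runs_let; first by apply: (runs_call (body := branch_body r)) runA runo.
  eapply (@runs_ifF _ _ _ _ false); [ev | by [] | ].
  by apply: (runs_call (body := guess_body)) runo' => //; ev.
by rewrite (mulSn (size Xs)); move: (size Xs * (C + b ^ 14 + 100)) (b ^ 14); clear; lia.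
Qed.

(** One power below [Q0], so that a thousand such costs fit into [Q0]. *)
Let Q1 := b ^ (r + 19).

Lemma Q1_Q0 : 1000 * Q1 <= Q0.
Proof. by rewrite /Q0 (addnS r 19); exact: (b_pow hb). Qed.

Lemma b_Q1 m : m <= 19 -> b ^ m <= Q1.
Proof. by move=> h; apply: b_le; rewrite (leq_trans h) // leq_addl. Qed.

Lemma Q1_gt0 : 0 < Q1. Proof. exact: (b_gt0 hb). Qed.

(** The factor paid per reduction of the list. It has to exceed the at most [b ^ r] guesses with
    their overhead, and also [n + 1], for the recurrence of a heavy vertex. *)
Let M := b ^ (r + 2).
Let leaf_cost T := (Q0 + T) * (4 * b).
(** Fits both recurrences. A guess, or the inclusion of a heavy vertex, lowers [j] and so gains a
    factor [M]. Exclusion keeps [j] but lowers [n]; as such steps form a chain, the dependence on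
    [n] is linear rather than exponential. *)
Definition branch_cost T j n := n.+1 * (M ^ j * leaf_cost T).

Lemma Q0_leaf T : Q0 + T <= leaf_cost T.
Proof. by rewrite leq_pmulr // muln_gt0 /b addnS. Qed.

Lemma leaf_le T j : leaf_cost T <= M ^ j * leaf_cost T.
Proof. by apply: leq_pmull; rewrite expn_gt0 (b_gt0 hb). Qed.

Lemma M_ge : 2 * b ^ r + 1 <= M.
Proof.
rewrite /M expnD; have := b_gt0 hb r; have := b_pow2 hb.
have : 1000 <= b by rewrite /b leq_addl.
by move: (b ^ r) (b ^ 2) (b) => *; nia.
Qed.

Lemma M_gen n : n <= #|G| -> n.+2 <= M.
Proof.
move=> le; apply: (@leq_trans b); last by rewrite -[X in X <= _]expn1; apply: b_le; rewrite addnS.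
by rewrite /b -addn2 leq_add // -addnA (leq_trans le) ?leq_addr.
Qed.

Lemma leaf_cost_ok T j n : n <= #|G| -> split_cost T n + 60 <= branch_cost T j n.
Proof.
move=> le; apply: (@leq_trans (leaf_cost T)); last first.
  by apply: leq_trans (leaf_le T j) _; apply: leq_pmull.
have h : 4 * n + 2 <= 4 * b.
  have : n + 1000 <= b by rewrite leq_add2r -addnA (leq_trans le) ?leq_addr.
  by move: (b); clear; lia.
apply: (@leq_trans ((Q0 + T) * (4 * n + 2))); last by rewrite leq_mul2l h orbT.
have -> : (Q0 + T) * (4 * n + 2) = (Q0 + T) * (4 * n + 1) + (Q0 + T) by rewrite -mulnSr addnS.
apply: leq_add; first by rewrite leq_mul2l; apply/orP; right; case: (n) => // m /=; clear; lia.
by have := Q1_Q0; have := Q1_gt0; move: (Q0) (Q1); clear; lia.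
Qed.

Lemma and_cost_ok T j n n1 n2 C : n <= #|G| -> n1 <= n -> n2 < n -> C <= Q0 ->
  branch_cost T j n1 + branch_cost T j.+1 n2 + C <= branch_cost T j.+1 n.
Proof.
move=> le le1 lt2 hC; rewrite /branch_cost (expnS M j) -mulnA.
have hy : C <= M ^ j * leaf_cost T.
  by apply: leq_trans (leaf_le T j); apply: leq_trans (Q0_leaf T); apply: leq_trans hC _; exact: leq_addr.
move: (M ^ j * leaf_cost T) hy => y hy.
have h1 : n1.+1 * y <= n.+1 * y by rewrite leq_mul2r ltnS le1 orbT.
have h2 : n2.+1 * (M * y) <= n * (M * y) by rewrite leq_mul2r lt2 orbT.
have h3 : n.+2 * y <= M * y by rewrite leq_mul2r M_gen ?orbT.
move: h1 h2 h3 hy; rewrite (mulSn n (M * y)) (mulSn n.+1 y).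
by move: (n1.+1 * y) (n2.+1 * (M * y)) (n * (M * y)) (M * y) (n.+1 * y); clear; lia.
Qed.

Lemma guess_cost_ok T j n X C : X <= b ^ r -> C + 20 <= Q0 ->
  X * (branch_cost T j n + b ^ 14 + 100) + 20 + C <= branch_cost T j.+1 n.
Proof.
move=> hX hC; rewrite /branch_cost (expnS M j) -mulnA.
have hQ : Q0 <= M ^ j * leaf_cost T.
  by apply: leq_trans (leaf_le T j); apply: leq_trans (Q0_leaf T); exact: leq_addr.
have hy : b ^ 14 + 100 <= M ^ j * leaf_cost T.
  apply: leq_trans hQ; have := Q1_Q0; have := Q1_gt0; have := b_Q1 (isT : 14 <= 19).
  by move: (Q0) (Q1) (b ^ 14); clear; lia.
have {hC} hC : C + 20 <= M ^ j * leaf_cost T by apply: leq_trans hQ.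
rewrite -addnA [20 + C]addnC -[n.+1 * _ + _ + 100]addnA.
move: (M ^ j * leaf_cost T) (b ^ 14 + 100) hy hC {hQ} => y z hy hC.
apply: (@leq_trans (n.+1 * ((2 * b ^ r + 1) * y))); last first.
  by rewrite leq_mul2l leq_mul2r M_ge !orbT.
have -> : n.+1 * ((2 * b ^ r + 1) * y) = b ^ r * (n.+1 * y + n.+1 * y) + n.+1 * y.
  by move: (b ^ r); clear; lia.
have h1 : y <= n.+1 * y by rewrite leq_pmull.
apply: leq_add; last exact: leq_trans h1.
by apply: leq_mul => //; rewrite leq_add2l (leq_trans _ h1).
Qed.

Lemma branch_empty l T s j U : s <= 2 ^ l.+1 -> solve_ok l T -> uniq U ->
  solves (branch_body r) (branch_arg s U [::]) U (branchable s U [::]) (branch_cost T j (size U)).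
Proof.
move=> hs ok uU.
have [o [runo opto complo]] := split_solves hs ok uU (leqnn (size U)).
exists o; split=> // [|/branchable_nil]; last exact: complo.
apply: runs_le.
  eapply (@runs_ifF _ _ _ _ false); [ev | by [] | ].
  by apply: (runs_call (body := split_body)) runo => //; ev.
have := leaf_cost_ok T j (uniq_size uU).
by move: (split_cost _ _) (branch_cost _ _ _); clear; lia.
Qed.

Section BranchStep.
Variables (T s j : nat) (U : seq G) (Ps : seq (seq G)).
Hypotheses (uU : uniq U) (vPs : valid_p4s b Ps) (PsU : {in Ps, forall P, {subset P <= U}}).
Hypotheses (Ps0 : 0 < size Ps) (hj : size Ps * d ^ j.+1 < c ^ j.+1).
Hypothesis smaller : forall U' Ps', uniq U' -> valid_p4s b Ps' ->
  {in Ps', forall P, {subset P <= U'}} -> size Ps' * d ^ j < c ^ j ->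
  solves (branch_body r) (branch_arg s U' Ps') U' (branchable s U' Ps')
    (branch_cost T j (size U')).

Let szU : size U <= #|G| + r + 4. Proof. exact: uniq_size4. Qed.

Lemma run_heavy : runs p [:: branch_arg s U Ps]
  (Call f_heavy (cons_ (cons_ (fst_ (Var 0)) (fst_ (snd_ (snd_ (Var 0))))) (fst_ (snd_ (Var 0)))))
  (encl (filter (heavy c Ps) U)) (Q1 + 20).
Proof.
apply: runs_le; first by apply: (@runs_heavy c r b G w hb) => //; ev.
by have := b_Q1 (isT : 17 <= 19); move: (b ^ 17) (Q1); clear; lia.
Qed.

Lemma run_isc_Ps : runs p [:: branch_arg s U Ps] (isc_ (fst_ (snd_ (snd_ (Var 0))))) (Num true) 5.
Proof. by apply: runs_le; [apply: runs_op1; [ev | rewrite isc_encode_seq Ps0] | ]. Qed.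

Lemma branch_light : filter (heavy c Ps) U = [::] ->
  solves (branch_body r) (branch_arg s U Ps) U (branchable s U Ps) (branch_cost T j.+1 (size U)).
Proof.
move=> EH.
have light : {in U, forall x, ~~ heavy c Ps x}.
  by move=> x xU; apply/negP => hx; have := mem_filter (heavy c Ps) x U; rewrite EH hx xU.
(* The padding of guessed tuples needs a vertex of [U]; one is found on any P4 of the nonempty
   list. *)
have U0 : U != [::].
  case: (Ps) vPs PsU Ps0 => // P Ps' [_ s4] sub _.
  have := s4 P (mem_head _ _); have := sub P (mem_head _ _).
  by case: P {s4 sub} => // x P /(_ x (mem_head _ _)); case: (U).
have sX : {in tuples U r, forall X, size X <= #|G| + r + 4}.
  by move=> X /tuplesP[-> _]; rewrite -addnA addnCA leq_addr.
have hX : {in tuples U r, forall X, solves (branch_body r)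
    (branch_arg s U (filter (touched X) Ps)) U (branchable s U (filter (touched X) Ps))
    (branch_cost T j (size U))}.
  move=> X /tuplesP[szX XU]; apply: smaller => //; first exact: valid_filter.
    by move=> P; rewrite mem_filter => /andP[_ /PsU].
  apply: geometric_drop hj; apply: leq_trans (size_touched light XU) _.
  by rewrite szX leq_mul2r /d leq_addr orbT.
have [o [runo opto complo]] := guess_solves uU vPs sX hX.
exists o; split=> // [|/(branchable_guess U0)]; last exact: complo.
apply: runs_le.
  eapply (@runs_ifT _ _ _ _ true); [exact: run_isc_Ps | by [] | ].
  eapply runs_let; first exact: run_heavy.
  eapply (@runs_ifF _ _ _ _ false); [by rewrite EH; ev | by [] | ].
  apply: (runs_call (body := guess_body)) runo => //.
  eapply runs_op2; [ | by ev | reflexivity].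
  apply: (@runs_tup c r b G hb _ _ U) => //; last by ev.
  by rewrite /b; move: (#|G|) (r) (c); clear; lia.
have h : Q1 + b ^ r.+3 + 100 <= Q0 /\ Q1 + b ^ r.+3 + 100 + 20 <= Q0.
  have := Q1_Q0; have := Q1_gt0; have : b ^ r.+3 <= Q1 by apply: b_le; rewrite -(addn3 r) leq_add2l.
  by move: (Q0) (Q1) (b ^ r.+3); clear; lia.
have := guess_cost_ok T j (size U) (tuples_size hb r szU) h.2.
move: (size _ * _) (branch_cost _ j.+1 _) (Q1) (b ^ r.+3); clear; lia.
Qed.

Lemma branch_heavy u hv : filter (heavy c Ps) U = u :: hv ->
  (forall U' Ps', size U' < size U -> uniq U' -> valid_p4s b Ps' ->
    {in Ps', forall P, {subset P <= U'}} -> size Ps' * d ^ j.+1 < c ^ j.+1 ->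
    solves (branch_body r) (branch_arg s U' Ps') U' (branchable s U' Ps')
      (branch_cost T j.+1 (size U'))) ->
  solves (branch_body r) (branch_arg s U Ps) U (branchable s U Ps) (branch_cost T j.+1 (size U)).
Proof.
move=> EH smaller_graph.
have /andP[hu uU'] : heavy c Ps u && (u \in U) by rewrite -mem_filter EH mem_head.
set U1 := [seq y <- U | ~~ closed_nbr u y]; set Ps1 := [seq P <- Ps | ~~ touched [:: u] P].
set U2 := [seq y <- U | y != u]; set Ps2 := [seq P : seq G <- Ps | u \notin P].
have uU1 : uniq U1 by apply: filter_uniq.
have uU2 : uniq U2 by apply: filter_uniq.
have U1U : {subset U1 <= U} by move=> y; rewrite mem_filter => /andP[].
have U2U : {subset U2 <= U} by move=> y; rewrite mem_filter => /andP[].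
have vPs1 : valid_p4s b Ps1 by apply: valid_filter.
have vPs2 : valid_p4s b Ps2 by apply: valid_filter.
have sub1 : {in Ps1, forall P, {subset P <= U1}}.
  move=> P; rewrite mem_filter => /andP[tP PPs] y yP; rewrite mem_filter (PsU PPs) // andbT.
  by apply: contra tP => uy; apply/touchedP; exists u, y; rewrite mem_head.
have sub2 : {in Ps2, forall P, {subset P <= U2}}.
  move=> P; rewrite mem_filter => /andP[uP PPs] y yP; rewrite mem_filter (PsU PPs) // andbT.
  by apply: contraNneq uP => <-.
(* Including [u] discards every P4 touched by [u], which is at least a 1/c fraction of the list. *)
have drop1 : size Ps1 * d ^ j < c ^ j.
  apply: geometric_drop hj.
  have := count_predC (touched [:: u]) Ps; rewrite -!size_filter -/Ps1.
  move: hu; rewrite /heavy; have -> : c = d.+1 by rewrite /c /d addnS.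
  by move: (size _) (size Ps1) (size Ps) => a1 a2 a3; nia.
have drop2 : size Ps2 * d ^ j.+1 < c ^ j.+1.
  by apply: leq_ltn_trans hj; rewrite leq_mul2r size_filter count_size orbT.
have sU1 : size U1 <= size U by rewrite size_filter count_size.
have sU2 : size U2 < size U.
  have := size_nbrs uU uU'; rewrite -/U1 => _.
  by rewrite -(count_predC (pred1 u) U) (count_uniq_mem u uU) uU' size_filter.
have [o1 [run1 opt1 compl1]] := smaller uU1 vPs1 sub1 drop1.
have [o2 [run2 opt2 compl2]] := smaller_graph U2 Ps2 sU2 uU2 vPs2 sub2 drop2.
have br1 : branchable s U Ps -> branchable s U1 Ps1.
  apply: branchable_sub => // P; rewrite mem_filter => /andP[_ /tuplesP[_ PU1]] PPs.
  rewrite mem_filter PPs andbT; apply/touchedP => -[x [y []]]; rewrite inE => /eqP-> /PU1.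
  by rewrite mem_filter => /andP[/negP].
have br2 : branchable s U Ps -> branchable s U2 Ps2.
  apply: branchable_sub => // P; rewrite mem_filter => /andP[_ /tuplesP[_ PU2]] PPs.
  rewrite mem_filter PPs andbT; apply/negP => /PU2.
  by rewrite mem_filter eqxx.
have runA1 : runs p [:: encode_vertex u; encl (u :: hv); branch_arg s U Ps]
    (let a := Var 2 in
     cons_ (fst_ a) (cons_ (Call f_non_nbr (cons_ (cons_ (fst_ a) (Var 0)) (fst_ (snd_ a))))
      (cons_ (Call f_untouched (cons_ (cons_ (fst_ a) (singleton_ (Var 0)))
         (fst_ (snd_ (snd_ a))))) (snd_ (snd_ (snd_ a)))))) (branch_arg s U1 Ps1) (2 * Q1 + 50).
  apply: runs_le.
    eapply runs_op2; [by ev | | reflexivity].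
    eapply runs_op2; [ | | reflexivity].
      by apply: (@runs_non_nbr c r b G w hb) => //; ev.
    eapply runs_op2; [ | by ev | reflexivity].
    apply: (@runs_untouched c r b G w hb _ _ [:: u]) => //; last by ev.
    by rewrite addnS.
  have := b_Q1 (isT : 14 <= 19); have := b_Q1 (isT : 4 <= 19).
  by move: (b ^ 14) (b ^ 4) (Q1); clear; lia.
have runA2 v1 : runs p [:: v1; encode_vertex u; encl (u :: hv); branch_arg s U Ps]
    (let a := Var 3 in
     cons_ (fst_ a) (cons_ (Call f_remove (cons_ (Var 1) (fst_ (snd_ a))))
      (cons_ (Call f_avoid (cons_ (Var 1) (fst_ (snd_ (snd_ a))))) (snd_ (snd_ (snd_ a))))))
    (branch_arg s U2 Ps2) (2 * Q1 + 50).
  apply: runs_le.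
    eapply runs_op2; [by ev | | reflexivity].
    eapply runs_op2; [ | | reflexivity].
      by apply: (@runs_remove c r b G hb) => //; ev.
    eapply runs_op2; [ | by ev | reflexivity].
    by apply: (@runs_avoid c r b G hb) => //; ev.
  have := b_Q1 (isT : 8 <= 19); have := b_Q1 (isT : 4 <= 19).
  by move: (b ^ 8) (b ^ 4) (Q1); clear; lia.
have costs : branch_cost T j (size U1) + branch_cost T j.+1 (size U2) + (8 * Q1 + 500)
    <= branch_cost T j.+1 (size U).
  apply: and_cost_ok => //; first exact: uniq_size.
  by have := Q1_Q0; have := Q1_gt0; move: (Q0) (Q1); clear; lia.
case: o1 run1 opt1 compl1 => [S1|] run1 opt1 compl1; last first.
  exists None; split=> // [|hbr]; last by case: (compl1 (br1 hbr)).
  apply: runs_le.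
    eapply (@runs_ifT _ _ _ _ true); [exact: run_isc_Ps | by [] | ].
    eapply runs_let; first exact: run_heavy.
    eapply (@runs_ifT _ _ _ _ true); [by rewrite EH; ev | by [] | ].
    eapply runs_let; first by rewrite EH; ev.
    eapply runs_let; first by rewrite EH; apply: (runs_call (body := branch_body r)) runA1 run1.
    by eapply (@runs_ifF _ _ _ _ false); [ev | by [] | ev].
  move: costs.
  by move: (branch_cost _ _ _) (branch_cost _ _ (size U2)) (branch_cost _ _ (size U)) (Q1); clear; lia.
case: o2 run2 opt2 compl2 => [S2|] run2 opt2 compl2; last first.
  exists None; split=> // [|hbr]; last by case: (compl2 (br2 hbr)).
  apply: runs_le.
    eapply (@runs_ifT _ _ _ _ true); [exact: run_isc_Ps | by [] | ].
    eapply runs_let; first exact: run_heavy.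
    eapply (@runs_ifT _ _ _ _ true); [by rewrite EH; ev | by [] | ].
    eapply runs_let; first by rewrite EH; ev.
    eapply runs_let; first by rewrite EH; apply: (runs_call (body := branch_body r)) runA1 run1.
    eapply (@runs_ifT _ _ _ _ true); [by ev | by [] | ].
    eapply runs_let; first by rewrite EH; apply: (runs_call (body := branch_body r)) (runA2 _) run2.
    by eapply (@runs_ifF _ _ _ _ false); [ev | by [] | ev].
  move: costs.
  by move: (branch_cost _ _ _) (branch_cost _ _ (size U2)) (branch_cost _ _ (size U)) (Q1); clear; lia.
have {}opt1 := opt1 _ erefl; have {}opt2 := opt2 _ erefl.
have opt := optimal_branch w0 uU' opt1 opt2.
exists (Some (better w (u :: S1) S2)); split=> // [|S' [<-]] //.
have sz1 : size (u :: S1) <= #|G| + r + 4.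
  by apply: uniq_size4; have [h _] := opt1; have [] := indep_in_cons uU' h.
have sz2 : size S2 <= #|G| + r + 4 by apply: uniq_size4; have [[]] := opt2.
apply: runs_le.
  eapply (@runs_ifT _ _ _ _ true); [exact: run_isc_Ps | by [] | ].
  eapply runs_let; first exact: run_heavy.
  eapply (@runs_ifT _ _ _ _ true); [by rewrite EH; ev | by [] | ].
  eapply runs_let; first by rewrite EH; ev.
  eapply runs_let; first by rewrite EH; apply: (runs_call (body := branch_body r)) runA1 run1.
  eapply (@runs_ifT _ _ _ _ true); [by ev | by [] | ].
  eapply runs_let; first by rewrite EH; apply: (runs_call (body := branch_body r)) (runA2 _) run2.
  eapply (@runs_ifT _ _ _ _ true); [by ev | by [] | ].
  eapply runs_let; first by ev.
  apply: (@runs_better (fun s => enc_res (Some s)) _ _ _ _ _ (u :: S1) S2 _ _ 5).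
  - by apply: (@runs_weight c r b G w hb) => //; ev.
  - by apply: (@runs_weight c r b G w hb) => //; ev.
  - by apply: runs_le; [ev | ].
  - by apply: runs_le; [ev | ].
move: costs; have := b_Q1 (isT : 4 <= 19).
by move: (branch_cost _ _ _) (branch_cost _ _ (size U2)) (branch_cost _ _ (size U)) (Q1) (b ^ 4); clear; lia.
Qed.
End BranchStep.

Lemma branch_solves l T s j U Ps : s <= 2 ^ l.+1 -> solve_ok l T ->
  uniq U -> valid_p4s b Ps -> {in Ps, forall P, {subset P <= U}} ->
  size Ps * d ^ j < c ^ j ->
  solves (branch_body r) (branch_arg s U Ps) U (branchable s U Ps) (branch_cost T j (size U)).
Proof.
move=> hs ok; elim: j U Ps => [|j IHj] U Ps.
  (* For [j = 0] the invariant reads [size Ps < 1]. *)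
  case: Ps => [*|P Ps]; first exact: branch_empty hs ok _.
  by rewrite !expn0 muln1.
(* An inner induction on the size of [U], at fixed [j], handles the branch that excludes a heavy
   vertex. *)
move: {2}(size U) (leqnn (size U)) => n; elim: n U Ps => [|n IHn] U [|P Ps] hn uU vPs PsU hj.
1,3: exact: branch_empty hs ok uU.
all: case EH : (filter (heavy c (P :: Ps)) U) => [|u hv]; first exact: branch_light EH.
  by case: (U) hn EH.
by apply: branch_heavy EH _ => // U' Ps' lt; apply: IHn; rewrite -ltnS (leq_trans lt).
Qed.

(** * The recursion on halved sets and its running time *)

Lemma solve_small T : Q0 <= T -> forall U, uniq U -> size U <= 1 ->
  solves solve_body (Cons encg (encl U)) U (has_good_bags G k) T.
Proof.
move=> hT U uU hU; exists (Some U); split=> // [|S [<-]]; last exact: optimal_small.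
apply: runs_le.
  eapply (@runs_ifT _ _ _ _ (size U <= 1)); [ | by [] | by ev].
  by eapply runs_op2; [apply: (@runs_len c r b G hb _ _ U); [exact: uniq_size4 | ev] | ev | reflexivity].
apply: leq_trans hT.
have := Q1_Q0; have := Q1_gt0; have := b_Q1 (isT : 2 <= 19).
by move: (b ^ 2) (Q0) (Q1); clear; lia.
Qed.

Lemma good_branchable U : uniq U -> has_good_bags G k -> branchable (size U) U (p4s U).
Proof. by move=> uU good; have [B [npk bal]] := good U uU; split=> //; exists B; split. Qed.

Lemma solve_step l T j : solve_ok l T -> b ^ 4 * d ^ j < c ^ j ->
  solve_ok l.+1 (Q0 + b * (M ^ j * leaf_cost T)).
Proof.
move=> ok hj U uU hU.
have [sU|sU] := leqP (size U) 1; first by apply: solve_small => //; exact: leq_addr.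
have szU := uniq_size4 uU.
have vp := valid_p4s_tuples hb szU.
have hPs : size (p4s U) * d ^ j < c ^ j.
  by apply: leq_ltn_trans hj; rewrite leq_mul2r; case: vp => -> _; rewrite orbT.
have sub : {in p4s U, forall P, {subset P <= U}}.
  by move=> P; rewrite mem_filter => /andP[_ /tuplesP[]].
have [o [runo opto complo]] := branch_solves hU ok uU vp sub hPs.
exists o; split=> // [|/(good_branchable uU)]; last exact: complo.
apply: runs_le.
  eapply (@runs_ifF _ _ _ _ (size U <= 1)); [ | by rewrite -ltnNge | ].
    by eapply runs_op2; [apply: (@runs_len c r b G hb _ _ U) => //; ev | ev | reflexivity].
  apply: (runs_call (body := branch_body r)) runo => //.
  eapply runs_op2; [by ev | | reflexivity].
  eapply runs_op2; [by ev | | reflexivity].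
  eapply runs_op2; [ | | reflexivity].
    by apply: (@runs_p4s c r b G w hb) => //; ev.
  by apply: (@runs_len c r b G hb _ _ U) => //; ev.
have h : branch_cost T j (size U) <= b * (M ^ j * leaf_cost T).
  rewrite /branch_cost leq_mul2r; apply/orP; right.
  by rewrite /b -addn1 leq_add // -addnA (leq_trans (uniq_size uU)) ?leq_addr.
have := Q1_Q0; have := Q1_gt0; have := b_Q1 (isT : 2 <= 19); have := b_Q1 (isT : 11 <= 19).
by move: h; move: (branch_cost _ _ _) (b * _) (b ^ 2) (b ^ 11) (Q0) (Q1); clear; lia.
Qed.

(** The number of reductions that empties any list of at most [b ^ 4] P4s. Since (c/d)^c is at least
    2, [c] reductions halve the list, and b^4 is below the power of 2 with exponent 4(log b + 1). *)
Let J := c * (4 * (trunc_log 2 b).+1).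
(** The exponent of [b] gained per level: [(r + 2) * J] from [M ^ J], [r + 20] from [Q0], and 20 to
    spare for the remaining factors [b] and constants. It is logarithmic, and there are
    logarithmically many levels. *)
Let E := (r + 2) * J + r + 40.

(** The first two terms of the binomial expansion of the right-hand side. *)
Lemma succ_pow_ge e n : e ^ n.+1 + n.+1 * e ^ n <= e.+1 ^ n.+1.
Proof.
elim: n => [|n IHn]; first by rewrite !expn1 expn0 muln1 addn1.
rewrite [e.+1 ^ _]expnS; apply: leq_trans (leq_mul (leqnn e.+1) IHn).
rewrite !expnS; move: (e ^ n) => x; nia.
Qed.

Lemma enough_rounds : b ^ 4 * d ^ J < c ^ J.
Proof.
have cd : c = d.+1 by rewrite /c /d addnS.
have d0 : 0 < d by rewrite /d addnS.
have double : 2 * d ^ c <= c ^ c.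
  rewrite cd; apply: leq_trans (succ_pow_ge d d).
  by rewrite !expnS; move: (d ^ d) => x; nia.
rewrite /J; set m := 4 * _; rewrite (expnM d c m) (expnM c c m).
apply: (@leq_trans ((2 * d ^ c) ^ m)); last by apply: leq_expl.
rewrite expnMn ltn_pmul2r ?expn_gt0 ?d0 //.
by rewrite /m mulnC expnM ltn_exp2r // trunc_log_ltn.
Qed.

Definition solve_time l := b ^ (E * l.+1).

Lemma solve_ok_time l : solve_ok l (solve_time l).
Proof.
elim: l => [|l IHl].
  move=> U uU hU; apply: solve_small => //; rewrite /solve_time muln1; apply: b_le.
  by rewrite /E -addnA addnCA leq_add2l (leq_trans _ (leq_addl _ _)).
move=> U uU hU; have [o [runo opto complo]] := solve_step IHl enough_rounds uU hU.
exists o; split=> //; apply: runs_le runo _.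
rewrite /solve_time [E * l.+2]mulnS expnD -/(solve_time l).
have t0 : 0 < solve_time l by exact: (b_gt0 hb).
have h0 : 0 < Q0 by exact: (b_gt0 hb).
have h1 : Q0 + solve_time l <= 2 * (Q0 * solve_time l).
  by move: (Q0) (solve_time l) t0 h0 => x y; nia.
have h2 : leaf_cost (solve_time l) <= b ^ 2 * (Q0 * solve_time l).
  apply: leq_trans (leq_mul h1 (leqnn _)) _.
  have := b_pow2 hb; move: (Q0 * solve_time l) (b ^ 2) (b) => x y z; nia.
have h3 : b * (M ^ J * leaf_cost (solve_time l)) <= b ^ ((r + 2) * J + r + 23) * solve_time l.
  have -> : (r + 2) * J + r + 23 = 1 + (r + 2) * J + 2 + (r + 20) by clear; lia.
  rewrite (expnD b (1 + (r + 2) * J + 2)) (expnD b (1 + (r + 2) * J) 2) (expnD b 1) expn1.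
  rewrite -/Q0 -!mulnA leq_mul2l; apply/orP; right; rewrite -expnM.
  by apply: leq_mul => //; rewrite (mulnA b b); exact: h2.
have h4 : Q0 <= b ^ ((r + 2) * J + r + 23) * solve_time l.
  apply: leq_trans (leq_pmulr _ t0); apply: b_le; rewrite -addnA addnCA leq_add2l.
  exact: (leq_trans _ (leq_addl _ _)).
apply: (leq_trans (leq_add h4 h3)).
rewrite addnn -mul2n mulnA leq_mul2r; apply/orP; right.
apply: (@leq_trans (b ^ ((r + 2) * J + r + 24))); last by apply: b_le; rewrite leq_add2l.
rewrite (addnS ((r + 2) * J + r) 23); have := b_pow hb ((r + 2) * J + r + 23).
by move: (b ^ _) (b ^ _.+1); clear; lia.
Qed.

Lemma program_correct : exists (o : option (seq G)) (t : nat),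
  [/\ run p encg (enc_res o) t, t <= solve_time (trunc_log 2 #|G|).+1 + 100 * b,
      forall S, o = Some S -> optimal w (enum G) S & has_good_bags G k -> o <> None].
Proof.
have sN : size (enum G) <= 2 ^ (trunc_log 2 #|G|).+1 by rewrite -cardE ltnW // trunc_log_ltn.
have [o [runo opto complo]] := solve_ok_time (enum_uniq G) sN.
have [t runt le] := runs_main hb runo.
by exists o, t.
Qed.

End Main.

(** * The time bound in terms of the number of vertices *)

Definition base k n := n + 4 * k + (4 * k + 2) + 1000.
Definition exponent k n :=
  (4 * k + 2) * ((4 * k + 2) * (4 * (trunc_log 2 (base k n)).+1)) + 4 * k + 40.
Definition time_bound k n :=
  base k n ^ (exponent k n * (trunc_log 2 n).+2) + 100 * base k n.

Lemma time_bound_npow k : npow_O_log2 (time_bound k).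
Proof.
(* The 12 comes from 4(l + 2), which is at most 12l because l is at least 1. *)
set a := (4 * k + 2) * ((4 * k + 2) * 12) + 4 * k + 40.
(* From [n >= 8 * k + 1002] on, the base is at most [2 * n] and hence at most [n ^ 2]. The factor 8
   is 2 from this square times 4 from the bound [4 * a * l ^ 2] on the exponent. *)
exists (8 * a), (8 * k + 1002) => n hn.
have n0 : 0 < n by apply: leq_trans hn; rewrite addnS.
set l := trunc_log 2 n.
have l1 : 0 < l by apply: (@trunc_log_max 2 n 1) => //; move: hn; clear; lia.
have hb : base k n <= 2 * n by rewrite /base; move: hn; clear; lia.
have hl : trunc_log 2 (base k n) <= l.+1.
  by apply: leq_trans (leq_trunc_log 2 hb) _; rewrite mul2n trunc_log2_double.
have he : exponent k n <= a * l.
  rewrite /exponent /a; move: (4 * k + 2) => c; move: (4 * k) => z.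
  rewrite -[X in X <= _]addnA -[X in X * l]addnA mulnDl -!mulnA.
  apply: leq_add; last by rewrite leq_pmulr.
  rewrite !leq_mul2l; apply/orP; right; apply/orP; right.
  by move: hl l1; clear; lia.
have b1000 : 1000 <= base k n by rewrite /base leq_addl.
have h2 : base k n <= n ^ 2 by apply: leq_trans hb _; rewrite expnS expn1 leq_mul2r; move: hn; clear; lia.
have hx : (exponent k n * l.+2).+1 <= 4 * a * l ^ 2.
  have : exponent k n * l.+2 <= a * l * (3 * l) by apply: leq_mul => //; move: l1; clear; lia.
  have : 0 < a * l ^ 2 by rewrite muln_gt0 expn_gt0 l1 andbT /a addnS.
  have -> : a * l * (3 * l) = 3 * (a * l ^ 2) by rewrite expnS expn1; clear; lia.
  have -> : 4 * a * l ^ 2 = 4 * (a * l ^ 2) by rewrite mulnA.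
  by move: (a * l ^ 2) (exponent k n * l.+2); clear; lia.
apply: (@leq_trans (base k n ^ (exponent k n * l.+2).+1)).
  rewrite /time_bound -/l expnS; set e := exponent k n * l.+2.
  have e2 : 0 < e by rewrite /e muln_gt0 /exponent addnS.
  have : base k n <= base k n ^ e by rewrite -[X in X <= _]expn1; apply: leq_pexp2l => //; move: b1000; clear; lia.
  by move: (base k n ^ e) b1000 => x; move: (base k n) => y; nia.
apply: (@leq_trans (base k n ^ (4 * a * l ^ 2))).
  by apply: leq_pexp2l => //; move: b1000; clear; lia.
apply: leq_trans (leq_expl _ h2) _.
by rewrite -expnM leq_pexp2l // !mulnA.
Qed.

Theorem theorem1p3 (H : sgraph -> Prop)
    (hH : exists (s : nat) (P : sgraph),
        [/\ 1 <= s <= 4, H P & graph_iso P (path_graph s)])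
    (k : nat) :
  exists (p : program) (T : nat -> nat),
    npow_O_log2 T /\
    forall (G : sgraph) (w : G -> rat), (forall x, (0 <= w x)%R) ->
      exists (v : value) (t : nat),
        [/\ run p (encode_graph w) v t,
            t <= T #|G|
          & (v = answer_report /\ k < tree_pi H G) \/
            (exists s : seq G,
               [/\ uniq s, v = answer_solution s
                 & max_weight_independent w [set x in s]])].
Proof.
exists (mis_program (4 * k + 2) (4 * k)), (time_bound k); split; first exact: time_bound_npow.
move=> G w w0; have [o [t [runo le opt compl]]] := program_correct k w0.
exists (enc_res o), t; split=> //.
case: o runo opt compl => [s|] _ opt compl; last first.
  left; split=> //; rewrite ltnNge; apply/negP => hk.
  by case: (compl (tree_pi_good_bags hH hk)).
right; exists s; have [[us _ ind] maxs] := opt s erefl; split=> //.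
split=> [x y|S' indS']; first by rewrite !inE; apply: ind.
by rewrite weight_seq //; apply: maxs; split=> // x _; rewrite mem_enum.
Qed.
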